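(* Let $N\in\mathbb{N}$ and $s>-1$. Define \[ \pi_N^{(s)}(x)=\frac{(p^{-1-s};p^{-1})_N^2(p^{-1};p^{-1})_N^2}{(p^{-1-s};p^{-1})_{2N}(p^{-1};p^{-1})_x^2(p^{-1};p^{-1})_{N-x}(p^{-1-s};p^{-1})_{N-x}}\,p^{-(N-x)^2-s(N-x)},\quad0\le x\le N. \] Then $\pi_N^{(s)}$ is a probability measure on $\{0,1,\dots,N\}$. Moreover, for every $\mathbf{k}\in\Delta_N$, setting $v_i=\sum_{j=-\infty}^{-i}l_j(\mathbf{k})$ for $i\ge0$ and $u_i=N-\sum_{j=-\infty}^{i}l_j(\mathbf{k})$ for $i\ge0$ (so $u_0=N-v_0$), \[ \mathsf{m}_N^{(s)}(\mathbf{k})=\pi_N^{(s)}(v_0)\prod_{i=0}^\infty\mathsf{P}^{(s)}(u_i,u_{i+1})\prod_{i=0}^\infty\mathsf{P}^{(0)}(v_i,v_{i+1}). \] Equivalently, a $\mathbf{k}$ with law $\mathsf{m}_N^{(s)}$ can be sampled by drawing $\sum_{i=-\infty}^0l_i(\mathbf{k})$ from $\pi_N^{(s)}$, then running from $N-\sum_{i=-\infty}^0l_i(\mathbf{k})$ a Markov chain with kernel $\mathsf{P}^{(s)}$ to produce $N-\sum_{i=-\infty}^1l_i(\mathbf{k}),N-\sum_{i=-\infty}^2l_i(\mathbf{k}),\dots$, and (independently given the starting point) running from $\sum_{i=-\infty}^0l_i(\mathbf{k})$ a Markov chain with kernel $\mathsf{P}^{(0)}$ to produce $\sum_{i=-\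infty}^{-1}l_i(\mathbf{k}),\sum_{i=-\infty}^{-2}l_i(\mathbf{k}),\dots$.
   Context: $(\alpha;q)_N=\prod_{j=0}^{N-1}(1-\alpha q^j)$. $\mathsf{vol}$ is the Haar measure on $\mathrm{Mat}(N,\mathbb{Q}_p)$ with $\mathsf{vol}(\mathrm{Mat}(N,\mathbb{Z}_p))=1$. Every $\mathbf{Z}\in\mathrm{Mat}(N,\mathbb{Q}_p)$ is $\mathbf{B}\,\mathrm{diag}(p^{-k_1},\dots,p^{-k_N})\,\mathbf{C}$ with $\mathbf{B},\mathbf{C}\in\mathrm{GL}(N,\mathbb{Z}_p)$ and unique $k_1\ge\dots\ge k_N\ge-\infty$ ($p^{-(-\infty)}=0$); $\mathsf{Sing}_N(\mathbf{Z})=(k_1,\dots,k_N)\in\Delta_N=\{(k_1,\dots,k_N)\in(\mathbb{Z}\cup\{-\infty\})^N:k_1\ge\dots\ge k_N\}$. $l_i(\mathbf{k})=\#\{j:k_j=i\}$ for $i\in\mathbb{Z}\cup\{-\infty\}$; sums $\sum_{j=-\infty}^m$ run over $\{-\infty\}\cup\{j\in\mathbb{Z}:j\le m\}$. $\gamma(\mathbf{Z})=\prod_{j:k_j>0}p^{k_j}$ ($=1$ if none); $d\mathsf{M}_N^{(s)}(\mathbf{Z})=\frac{(p^{-1-s};p^{-1})_N^2}{(p^{-1-s};p^{-1})_{2N}}\gamma(\mathbf{Z})^{-s-2N}d\mathsf{vol}(\mathbf{Z})$ is a probability measure and $\mathsf{m}_N^{(s)}=(\mathsf{Sing}_N)_*\mathsf{M}_N^{(s)}$.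 For $s>-1$, $\mathsf{P}^{(s)}(x_1,x_2)=\frac{p^{-x_2^2-sx_2}(p^{-1};p^{-1})_{x_1}(p^{-1-s};p^{-1})_{x_1}}{(p^{-1};p^{-1})_{x_2}(p^{-1};p^{-1})_{x_1-x_2}(p^{-1-s};p^{-1})_{x_2}}\mathbf{1}(0\le x_2\le x_1)$ for $x_1,x_2\in\mathbb{Z}_+$; it is a Markov kernel on $\mathbb{Z}_+$. *)

(* Defs.v *)
From HB Require Import structures.
From mathcomp Require Import all_boot all_order all_algebra.
From mathcomp Require Import all_classical all_reals all_analysis.
Set Implicit Arguments. Unset Strict Implicit. Unset Printing Implicit Defensive.
Import Order.TTheory GRing.Theory Num.Theory.
Local Open Scope classical_set_scope.
Local Open Scope ring_scope.

Section Defs.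
Variable R : realType.
Variables (p N : nat).

Definition qpoch (alpha q : R) (n : nat) : R := \prod_(j < n) (1 - alpha * q ^+ j).

Definition pR : R := p%:R.
Definition qinv : R := pR^-1.
Definition aS (s : R) : R := pR `^ (-1 - s).

(* An element of Q_p is represented by its base-p digit function
   (digit at position j : int, i.e. coefficient of p^j).  An element of Z_p
   by a digit function nat -> nat.  A matrix over Q_p is an N x N array. *)
Definition qpmat := 'I_N -> 'I_N -> int -> nat.
Definition zpmat := 'I_N -> 'I_N -> nat -> nat.

Definition res (n : nat) (a : nat -> nat) : int := (\sum_(j < n) a j * p ^ j)%N%:Z.
(* residue mod p^n of p^m z, for z : Q_p whose digits below -m vanish *)
Definition resq (n m : nat) (z : int -> nat) : int :=
  (\sum_(j < n) z (j%:Z - m%:Z)%R * p ^ j)%N%:Z.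

Definition isGL (B : zpmat) : Prop :=
  (forall a b j, (B a b j < p)%N) /\
  exists C : zpmat, (forall a b j, (C a b j < p)%N) /\
   forall (n : nat) (a b : 'I_N),
    ((p ^ n)%:Z %| (\sum_(c < N) res n (B a c) * res n (C c b)) - (a == b)%:Z)%Z /\
    ((p ^ n)%:Z %| (\sum_(c < N) res n (C a c) * res n (B c b)) - (a == b)%:Z)%Z.

(** singular numbers: extended integers Z u {-oo}, None = -oo *)
Definition le_ext (x y : option int) : bool :=
  match x, y with
  | None, _ => true
  | Some _, None => false
  | Some a, Some b => (a <= b)%R
  end.

Definition sing_t := {ffun 'I_N -> option int}.

Definition inDelta (k : sing_t) : Prop :=
  forall i j : 'I_N, (i <= j)%N -> le_ext (k j) (k i).

(* entry p^{m - k_i} of p^m diag(p^{-k_1},...,p^{-k_N}) (0 if k_i = -oo) *)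
Definition dentry (m : nat) (ki : option int) : int :=
  match ki with Some a => (p ^ `|m%:Z - a|%N)%:Z | None => 0 end.

(* Z = B diag(p^{-k_1},...,p^{-k_N}) C with B, C in GL(N,Z_p), k in Delta_N.
   The matrix identity is checked after multiplying by p^m (any m making
   everything integral) and reducing modulo every p^n. *)
Definition sing_rel (Z : qpmat) (k : sing_t) : Prop :=
  inDelta k /\
  exists B C : zpmat, isGL B /\ isGL C /\
   forall m : nat,
    (forall a b (j : int), (j < - m%:Z)%R -> Z a b j = 0%N) ->
    (forall i, le_ext (k i) (Some m%:Z)) ->
    forall (n : nat) (a b : 'I_N),
     ((p ^ n)%:Z %| resq n m (Z a b) -
        \sum_(i < N) res n (B a i) * dentry m (k i) * res n (C i b))%Z.

Definition Sing (Z : qpmat) : sing_t := xget [ffun _ => None] (sing_rel Z).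

Definition gammaZ (Z : qpmat) : R :=
  \prod_(i < N) (if Sing Z i is Some a then (if (0 < a)%R then pR ^+ `|a|%N else 1) else 1).

(** Haar measure on Mat(N, Q_p): push-forward of Lebesgue measure on [0,+oo)
    by the measure-preserving digit map phi.  For x = n + f (n integer part,
    f in [0,1)), the base-p digits of f, dealt out round-robin to the N^2
    entries, give the Z_p-digits (positions >= 0), and the base-p digits of n,
    dealt out likewise, give the digits at negative positions.  This is a
    bijection (up to Lebesgue-null sets) [0,oo) ~ Mat(N,Q_p) sending
    Lebesgue measure to the Haar measure with vol(Mat(N,Z_p)) = 1. *)
Definition phi (x : R) : qpmat := fun a b j =>
  let t := (a * N + b)%N in
  let n := `|Num.floor x|%N in
  let f := x - (Num.floor x)%:~R in
  match j with
  | Posz i => (`|Num.floor (f * pR ^+ (i * N ^ 2 + t).+1)|%N %% p)%N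
  | Negz i => ((n %/ p ^ (i * N ^ 2 + t)) %% p)%N
  end.

Definition vol (A : set qpmat) : \bar R :=
  lebesgue_measure [set x : R | 0 <= x /\ A (phi x)].

Definition cM (s : R) : R := qpoch (aS s) qinv N ^+ 2 / qpoch (aS s) qinv (2 * N).

Definition MN (s : R) (A : set qpmat) : \bar R :=
  ((cM s)%:E * \int[lebesgue_measure]_(x in [set x : R | (0 <= x)%R /\ A (phi x)])
      (gammaZ (phi x) `^ (- s - 2 * N%:R))%:E)%E.

Definition mN (s : R) (k : sing_t) : \bar R := MN s [set Z | Sing Z = k].

Definition piN (s : R) (x : nat) : R :=
  qpoch (aS s) qinv N ^+ 2 * qpoch qinv qinv N ^+ 2 /
  (qpoch (aS s) qinv (2 * N) * qpoch qinv qinv x ^+ 2 *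
   qpoch qinv qinv (N - x) * qpoch (aS s) qinv (N - x)) *
  pR `^ (- ((N - x)%:R ^+ 2) - s * (N - x)%:R).

Definition Pker (s : R) (x1 x2 : nat) : R :=
  if (x2 <= x1)%N then
    pR `^ (- (x2%:R ^+ 2) - s * x2%:R) * qpoch qinv qinv x1 * qpoch (aS s) qinv x1 /
    (qpoch qinv qinv x2 * qpoch qinv qinv (x1 - x2) * qpoch (aS s) qinv x2)
  else 0.

(* #{ j : k_j <= c } (k_j = -oo counted) = sum_{j=-oo}^{c} l_j(k) *)
Definition cnt_le (k : sing_t) (c : int) : nat := #|[set t | le_ext (k t) (Some c)]|.
Definition vseq (k : sing_t) (i : nat) : nat := cnt_le k (- i%:Z).
Definition useq (k : sing_t) (i : nat) : nat := (N - cnt_le k i%:Z)%N.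

Definition partial_prod (s : R) (k : sing_t) (n : nat) : R :=
  piN s (vseq k 0) * (\prod_(i < n) Pker s (useq k i) (useq k i.+1)) *
  (\prod_(i < n) Pker 0 (vseq k i) (vseq k i.+1)).

End Defs.

(* Main.v *)
(** For an integer matrix A, let K_n(A) in F_p^N be the set of reductions mod p
    of the row vectors u with u A = 0 mod p^n.  If A is equivalent to
    diag(p^{l_1}, ..., p^{l_N}), then K_n(A) has p^{w_n} elements, where
    w_n = #{j : l_j >= n}; so these sizes determine the singular numbers.  Once
    A mod p^n is fixed, the Smith form of A identifies K_{n+1}(A + p^n X) with
    the kernel of a w_n x w_n matrix over F_p which is an affine surjective
    function of X.  Under Haar measure the w_n therefore form a Markov chain
    whose transition law is that of the corank of a uniform square matrix over
    F_p, and this law is P^(0).  Applied to p^m Z this gives the volume of the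
    set where w_1, ..., w_n are prescribed; the set {Sing = k} is the decreasing
    intersection of those sets, the two factors B and C being obtained from
    their approximations mod p^n by compactness.  On the levels k_j > 0, the
    factor gamma^{-s-2N} turns the kernel P^(0) into an h-transform of P^(s),
    and the resulting product telescopes. *)

Require Import Defs.
From HB Require Import structures.
From mathcomp Require Import all_boot all_order all_algebra.
From mathcomp Require Import all_classical all_reals all_analysis.
From mathcomp Require Import mxabelem ring lra zify.
Set Implicit Arguments. Unset Strict Implicit. Unset Printing Implicit Defensive.
Import Order.TTheory GRing.Theory Num.Theory.
Local Open Scope classical_set_scope.
Local Open Scope ring_scope.

(** * Kernels modulo p^n *)

Section LevelKernel.
Variables (p N : nat).
Hypothesis p_pr : prime p.

Local Notation red := (map_mx (intr : int -> 'F_p)).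
Local Notation pz n := ((p ^ n)%N%:Z).

Definition levelker (n : nat) (A : 'M[int]_N) : {set 'rV['F_p]_N} :=
  [set v | `[< exists u : 'rV[int]_N, exists y, red u = v /\ u *m A = pz n *: y >]]%SET.

Lemma levelkerP n A v :
  reflect (exists u : 'rV[int]_N, exists y, red u = v /\ u *m A = pz n *: y)
          (v \in levelker n A).
Proof. by rewrite inE; apply: asboolP. Qed.

Lemma intr_Fp_eq0 (z : int) : (z%:~R == 0 :> 'F_p) = (p %| z)%Z.
Proof. by rewrite (dvdz_pcharf (pchar_Fp p_pr)). Qed.

Lemma red_scale (n : nat) m k (E : 'M[int]_(m, k)) : red (pz n.+1 *: E) = 0.
Proof.
apply/matrixP=> i j; rewrite !mxE; apply/eqP.
by rewrite intr_Fp_eq0 expnS PoszM -mulrA dvdz_mulr.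
Qed.

Lemma red_lift m k (V : 'M['F_p]_(m, k)) : red (map_mx (fun x : 'F_p => (x : nat)%:Z) V) = V.
Proof.
by apply/matrixP=> i j; rewrite !mxE -pmulrn natr_Zp.
Qed.

Lemma levelker_eqmod n (A E : 'M[int]_N) : levelker n (A + pz n *: E) = levelker n A.
Proof.
apply/setP=> v; apply/levelkerP/levelkerP=> -[u [y [uv uA]]]; exists u.
  by exists (y - u *m E); rewrite scalerBr -uA mulmxDr -scalemxAr addrK.
by exists (y + u *m E); rewrite scalerDr -uA mulmxDr -scalemxAr.
Qed.

(** Since p does not divide [\det B], Bezout inverts the determinant modulo p^n, and the adjugate
    times that inverse works on both sides. *)
Lemma inverse_mod (n : nat) (B : 'M[int]_N) : red B \in unitmx ->
  exists B' E E' : 'M[int]_N, B' *m B = 1%:M + pz n *: E /\ B *m B' = 1%:M + pz n *: E'.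
Proof.
rewrite unitmxE unitfE det_map_mx intr_Fp_eq0 => pB.
have : coprimez (\det B) (pz n).
  rewrite coprimezE /= coprime_sym; case: n => [|n]; first by rewrite expn0 coprime1n.
  by rewrite coprime_pexpl // prime_coprime.
case/coprimezP=> -[u c] /= uc.
have uE : u * \det B = 1 - pz n * c by rewrite -uc mulrC [c * _]mulrC; ring.
exists (u *: \adj B), ((- c)%:M), ((- c)%:M).
rewrite -scalemxAl -scalemxAr mul_adj_mx mul_mx_adj !scale_scalar_mx uE.
by rewrite mulrN raddfD; split.
Qed.

(** C is invertible modulo p^n, so it does not change the kernel, and B only transports it by v |->
    v [red B]. *)
Lemma card_levelker_mul n (A B C : 'M[int]_N) : red B \in unitmx -> red C \in unitmx ->
  #|levelker n (B *m A *m C)| = #|levelker n A|.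
Proof.
move=> uB uC.
have injB : injective (mulmxr (red B) : 'rV['F_p]_N -> _).
  exact: can_inj (mulmxK uB).
(* Inverses are taken modulo p^{n+1}, so that they remain inverses modulo p even when n = 0. *)
have [B' [E [E' [B'B BB']]]] := inverse_mod n.+1 uB.
have [C' [F [F' [C'C CC']]]] := inverse_mod n.+1 uC.
have pS : pz n.+1 = pz n * p%:Z by rewrite expnS mulnC PoszM.
rewrite -[RHS](card_preimset _ injB); apply: eq_card => v.
rewrite [RHS]inE; apply/levelkerP/levelkerP=> -[u [y [uv uA]]].
  exists (u *m B), (y *m C' - p%:Z *: (u *m B *m A *m F')); split.
    by rewrite map_mxM uv.
  rewrite scalerBr (scalemxAl _ y) -uA scalerA -pS !mulmxA -!mulmxA CC' !mulmxA.
  by rewrite mulmxDr mulmx1 -scalemxAr addrK.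
exists (u *m B'), ((y + p%:Z *: (u *m E *m A)) *m C); split.
  rewrite map_mxM uv /= -mulmxA -map_mxM BB' map_mxD red_scale addr0.
  by rewrite map_mx1 mulmx1.
rewrite !mulmxA -(mulmxA u) B'B mulmxDr mulmx1 -scalemxAr mulmxDl uA.
by rewrite [RHS]scalemxAl scalerDr scalerA -pS -!scalemxAl.
Qed.
Lemma dvd_row n (u : 'rV[int]_N) :
  (forall j, (pz n %| u 0%R j)%Z) <-> exists y, u = pz n *: y.
Proof.
split=> [pu|[y -> j]]; last by rewrite mxE dvdz_mulr.
exists (\row_j (u 0%R j %/ pz n)%Z); apply/rowP=> j.
by rewrite !mxE mulrC divzK.
Qed.

(** Right multiplication by [incl S] extends a vector on S by zero; right multiplication by its
    transpose restricts to the coordinates in S. *)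
Definition incl (S : {set 'I_N}) : 'M['F_p]_(#|S|, N) :=
  \matrix_(a, j) (j == enum_val a)%:R.

Lemma mul_incl (S : {set 'I_N}) (y : 'rV_#|S|) a : (y *m incl S) 0 (enum_val a) = y 0 a.
Proof.
rewrite mxE (bigD1 a) //= mxE eqxx mulr1 big1 ?addr0 // => b ba.
by rewrite mxE (inj_eq enum_val_inj) eq_sym (negbTE ba) mulr0.
Qed.

Lemma mul_incl_notin (S : {set 'I_N}) (y : 'rV_#|S|) j : j \notin S -> (y *m incl S) 0%R j = 0.
Proof.
move=> jS; rewrite mxE big1 // => a _; rewrite mxE.
by case: eqP => [ja|]; rewrite ?mulr0 //; move: jS; rewrite ja enum_valP.
Qed.

Lemma mul_inclT m (S : {set 'I_N}) (V : 'M['F_p]_(m, N)) i a :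
  (V *m (incl S)^T) i a = V i (enum_val a).
Proof.
rewrite mxE (bigD1 (enum_val a)) //= !mxE eqxx mulr1 big1 ?addr0 // => b ba.
by rewrite !mxE (negbTE ba) mulr0.
Qed.

Lemma incl_inj (S : {set 'I_N}) : injective (mulmxr (incl S) : 'rV_#|S| -> 'rV_N).
Proof. by move=> x y /= e; apply/rowP=> a; rewrite -!mul_incl e. Qed.

Lemma mul_inclK (S : {set 'I_N}) (v : 'rV['F_p]_N) : (forall j, j \notin S -> v 0%R j = 0) ->
  v *m (incl S)^T *m incl S = v.
Proof.
move=> vS; apply/rowP=> j; case: (boolP (j \in S)) => jS; last first.
  by rewrite mul_incl_notin // vS.
by rewrite -(enum_rankK_in jS jS) mul_incl mul_inclT.
Qed.

Lemma red_mul (u : 'rV[int]_N) (M : 'M[int]_N) j :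
  ((u *m M) 0 j)%:~R = (red u *m red M) 0 j.
Proof. by rewrite -map_mxM [RHS]mxE. Qed.

Definition dvdset n (d : 'rV[int]_N) : {set 'I_N} := [set j | (pz n %| d 0%R j)%Z]%SET.

Lemma dvd_of_mul_notdvd n (x d : int) : ~~ (pz n %| d)%Z -> (pz n %| x * d)%Z -> (p %| x)%Z.
Proof.
move=> nd xd; apply: contraNT nd => px.
suff cop : coprimez (pz n) x by rewrite -(Gauss_dvdzr _ cop).
rewrite coprimezE /=; case: n {xd} => [|n]; first by rewrite coprime1n.
by rewrite coprime_pexpl // prime_coprime.
Qed.

(** Outside S the entry d_j has valuation less than n. This forces the coordinate to vanish modulo
    p, and it also lets a multiple of p in that coordinate absorb any multiple of p^n modulo
    p^{n+1}. The equations indexed by S remain; divided by p^n, they form a linear system over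
    F_p. *)
Lemma levelker_diag_add n (d : 'rV[int]_N) (X : 'M[int]_N) :
  let S := dvdset n d in
  levelker n.+1 (diag_mx d + pz n *: X) =
  [set y *m incl S | y in
     [set y : 'rV_#|S| | y *m (incl S *m red (X + diag_mx (\row_j (d 0%R j %/ pz n)%Z)) *m
       (incl S)^T) == 0]]%SET.
Proof.
move=> S; set T := \row_j _.
have pn0 : pz n != 0 by rewrite eqz_nat -lt0n expn_gt0 prime_gt0.
have pS : pz n.+1 = pz n * p%:Z by rewrite expnS mulnC PoszM.
have uE (u : 'rV[int]_N) j : (u *m (diag_mx d + pz n *: X)) 0%R j =
    u 0%R j * d 0%R j + pz n * (u *m X) 0%R j.
  by rewrite mulmxDr -scalemxAr mxE mul_mx_diag !mxE.
have dS j : j \in S -> d 0%R j = pz n * (d 0%R j %/ pz n)%Z.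
  by rewrite inE => dj; rewrite mulrC divzK.
have uTE (u : 'rV[int]_N) j : (u *m (X + diag_mx T)) 0%R j =
    (u *m X) 0%R j + u 0%R j * (d 0%R j %/ pz n)%Z.
  by rewrite mulmxDr mxE mul_mx_diag !mxE.
apply/setP=> v; apply/levelkerP/imsetP => [[u [y [uv /esym uA]]]|[y]].
  have {}uA j : (pz n.+1 %| u 0%R j * d 0%R j + pz n * (u *m X) 0%R j)%Z.
    by rewrite -uE -uA mxE dvdz_mulr.
  have vS j : j \notin S -> v 0%R j = 0.
    rewrite inE -uv mxE => dj; apply/eqP; rewrite intr_Fp_eq0.
    apply: (dvd_of_mul_notdvd dj).
    rewrite -(rpredDr (u 0%R j * d 0%R j) (dvdz_mulr ((u *m X) 0%R j) (dvdzz (pz n)))).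
    by apply: dvdz_trans (uA j); rewrite pS dvdz_mulr.
  exists (v *m (incl S)^T); last by rewrite mul_inclK.
  rewrite inE !mulmxA mul_inclK //; apply/eqP/rowP=> a.
  rewrite mul_inclT [RHS]mxE -uv -map_mxM mxE uTE; apply/eqP; rewrite intr_Fp_eq0.
  have := uA (enum_val a); rewrite {1}(dS _ (enum_valP a)) mulrCA -mulrDr pS.
  by rewrite dvdz_mul2l // addrC.
rewrite inE => /eqP yY vE.
pose u0 : 'rV[int]_N := map_mx (fun x : 'F_p => (x : nat)%:Z) v.
have u0S j : j \notin S -> u0 0%R j = 0 by move=> jS; rewrite mxE vE mul_incl_notin.
have /choice [c cP] : forall j, exists c : int, j \notin S ->
    (p %| c)%Z /\ (pz n.+1 %| c * d 0%R j + pz n * (u0 *m X) 0%R j)%Z.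
  move=> j; case: (boolP (j \in S)) => [|jS]; first by exists 0.
  have : (gcdn `|d 0%R j| (p ^ n.+1) %| p ^ n.+1)%N by rewrite dvdn_gcdr.
  case/(dvdn_pfactor _ _ p_pr) => l _ gl.
  have ln : (l < n)%N.
    rewrite ltnNge; apply: contra jS => nl; rewrite inE dvdzE /=.
    by apply: dvdn_trans (dvdn_gcdl _ (p ^ n.+1)); rewrite gl dvdn_exp2l.
  have [a [b ab]] := Bezoutz (d 0%R j) (pz n.+1).
  rewrite /gcdz /= gl in ab.
  (* With p^l the gcd of d_j and p^{n+1}, Bezout gives a d_j + b p^{n+1} = p^l. Multiplying by
     p^{n-l} solves the equation for coordinate j, and l < n makes the correction divisible by p. *)
  exists (- a * pz (n - l) * (u0 *m X) 0%R j) => _; split.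
    by rewrite dvdz_mulr // dvdz_mull // dvdzE /= dvdn_exp // subn_gt0.
  have -> : pz n = pz (n - l) * pz l by rewrite -PoszM -expnD subnK // ltnW.
  rewrite -ab; set z := (_ *m _) 0%R j.
  have -> : - a * pz (n - l) * z * d 0%R j + pz (n - l) * (a * d 0%R j + b * pz n.+1) * z
     = pz n.+1 * (pz (n - l) * b * z) by ring.
  by rewrite dvdz_mulr.
pose u := \row_j (if j \in S then u0 0%R j else c j) : 'rV[int]_N.
have uv : red u = v.
  apply/rowP=> j; rewrite 2!mxE; case: ifPn => jS.
    by rewrite -[v in RHS]red_lift [RHS]mxE.
  by rewrite vE mul_incl_notin //; apply/eqP; rewrite intr_Fp_eq0; case: (cP j jS).
have uu0 j : (p %| (u *m X) 0%R j - (u0 *m X) 0%R j)%Z.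
  rewrite -intr_Fp_eq0 rmorphB /= subr_eq0; apply/eqP.
  by rewrite !red_mul uv red_lift.
suff /dvd_row [y' y'E] : forall j, (pz n.+1 %| (u *m (diag_mx d + pz n *: X)) 0%R j)%Z.
  by exists u, y'.
move=> j; rewrite uE; case: (boolP (j \in S)) => jS; last first.
  rewrite {1}/u mxE (negbTE jS).
  have -> : c j * d 0%R j + pz n * (u *m X) 0%R j =
     (c j * d 0%R j + pz n * (u0 *m X) 0%R j) + pz n * ((u *m X) 0%R j - (u0 *m X) 0%R j) by ring.
  apply: rpredD; first by case: (cP j jS).
  by rewrite pS dvdz_mul.
rewrite {1}(dS _ jS) mulrCA -mulrDr pS dvdz_mul2l // addrC -uTE -intr_Fp_eq0.
rewrite red_mul uv -(enum_rankK_in jS jS) -mul_inclT vE.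
by move: yY; rewrite !mulmxA => ->; rewrite mxE.
Qed.

Lemma card_levelker_diag n (d : 'rV[int]_N) :
  #|levelker n (diag_mx d)| = (p ^ #|dvdset n d|)%N.
Proof.
set S := dvdset n d.
suff -> : levelker n (diag_mx d) = [set y *m incl S | y in [set: 'rV_#|S|]]%SET.
  by rewrite (card_imset _ (@incl_inj S)) cardsT card_mx card_Fp // mul1n.
apply/setP=> v; apply/levelkerP/imsetP => [[u [y [uv uA]]]|[y _ vE]].
  exists (v *m (incl S)^T); rewrite ?inE // mul_inclK // => j; rewrite inE => dj.
  apply/eqP; rewrite -uv mxE intr_Fp_eq0; apply: (dvd_of_mul_notdvd dj).
  have := congr1 (fun M : 'rV_N => M 0%R j) uA.
  by rewrite mul_mx_diag !mxE => ->; rewrite dvdz_mulr.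
pose u : 'rV[int]_N := map_mx (fun x : 'F_p => (x : nat)%:Z) v.
suff /dvd_row [z zE] : forall j, (pz n %| (u *m diag_mx d) 0%R j)%Z.
  by exists u, z; rewrite red_lift.
move=> j; rewrite mul_mx_diag !mxE; case: (boolP (j \in S)) => jS.
  by rewrite dvdz_mull //; move: jS; rewrite inE.
by rewrite vE mul_incl_notin //= mul0r dvdz0.
Qed.

Lemma card_levelker_diag_add n (d : 'rV[int]_N) (X : 'M[int]_N) :
  let S := dvdset n d in
  #|levelker n.+1 (diag_mx d + pz n *: X)| = (p ^ (#|S| -
    \rank (incl S *m red (X + diag_mx (\row_j (d 0%R j %/ pz n)%Z)) *m (incl S)^T)))%N.
Proof.
move=> S; rewrite levelker_diag_add -/S (card_imset _ (@incl_inj S)); set Y := _ *m _ *m _.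
rewrite -mxrank_ker -[X in (X ^ _)%N](card_Fp p_pr) -card_rowg; apply: eq_card => y.
by rewrite mem_rowg inE; apply/eqP/sub_kermxP.
Qed.

End LevelKernel.

(** The hypothesis makes all fibres of [phi] translates of one another, so they have equal size. *)
Lemma card_affine_preim (V W : finZmodType) (phi : V -> W) (T : pred W) :
  (forall y, exists x0, forall x, phi (x + x0) = phi x + y) ->
  (#|[pred x | T (phi x)]| * #|W| = #|V| * #|T|)%N.
Proof.
move=> surj; pose k := #|[set x | phi x == 0]%SET|.
have fiber y : #|[set x | phi x == y]%SET| = k.
  have [x0 x0E] := surj y.
  rewrite /k -(card_preimset [set x | phi x == y]%SET (addIr x0)); apply: eq_card => x.
  by rewrite !inE x0E -subr_eq0 addrK.
have count (U : pred W) : #|[pred x | U (phi x)]| = (#|U| * k)%N.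
  rewrite -sum1_card (partition_big phi U) //= -sum_nat_const.
  apply: eq_bigr => y Uy; rewrite -(fiber y) -sum1_card; apply: eq_bigl => x.
  by rewrite !inE; case: eqP => [->|]; rewrite ?andbF // andbT.
rewrite count; have -> : #|V| = (#|W| * k)%N by rewrite -(count predT).
by rewrite mulnAC [in RHS]mulnAC (mulnC #|T|).
Qed.

(** The Smith form A = L D R replaces X by L^{-1} X R^{-1}, and only its block on the coordinates
    where p^n divides D matters for the next kernel. That block, shifted by D / p^n, is an affine
    surjective function of X, so its values are equidistributed over w x w matrices. *)
Lemma card_levelker_lift (p N : nat) (p_pr : prime p) n (A : 'M[int]_N) w c :
  #|levelker p n A| = (p ^ w)%N ->
  (#|[pred X : 'M['F_p]_N |
        #|levelker p n.+1 (A + (p ^ n)%N%:Z *: map_mx (fun x : 'F_p => (x : nat)%:Z) X)|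
          == (p ^ c)%N]| * p ^ (w * w) =
   p ^ (N * N) * #|[pred Y : 'M['F_p]_w | \rank Y + c == w]|)%N.
Proof.
have [L uL [R uR [d _ AE]]] := int_Smith_normal_form A.
pose dr : 'rV[int]_N := \row_j d`_j.
have {}AE : A = L *m diag_mx dr *m R.
  by rewrite AE; congr (_ *m _ *m _); apply/matrixP=> i j; rewrite !mxE.
pose red m k (M : 'M[int]_(m, k)) : 'M['F_p]_(m, k) := map_mx (intr : int -> 'F_p) M.
have ured (M : 'M[int]_N) : M \in unitmx -> red _ _ M \in unitmx.
  by rewrite /red !unitmxE det_map_mx; apply: rmorph_unit.
have uLr := ured _ uL; have uRr := ured _ uR.
have Lv : red _ _ (invmx L) *m red _ _ L = 1%:M by rewrite -map_mxM mulVmx // map_mx1.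
have Rv : red _ _ R *m red _ _ (invmx R) = 1%:M by rewrite -map_mxM mulmxV // map_mx1.
rewrite {1}AE (card_levelker_mul p_pr n _ uLr uRr) (card_levelker_diag p_pr).
move=> /(expnI (prime_gt1 p_pr)) => Sw; rewrite -{w}Sw.
set S := dvdset p n dr.
pose T : 'M['F_p]_N := diag_mx (map_mx (intr : int -> 'F_p) (\row_j (dr 0%R j %/ (p ^ n)%N%:Z)%Z)).
pose phi (X : 'M['F_p]_N) : 'M['F_p]_#|S| :=
  incl p S *m (red _ _ (invmx L) *m X *m red _ _ (invmx R) + T) *m (incl p S)^T.
have := @card_affine_preim _ _ phi [pred Y | \rank Y + c == #|S|]%N.
rewrite !card_mx card_Fp // => <-; last first.
  (* The block Y is extended by zero to an N x N matrix and transported back by L and R. *)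
  move=> Y; exists (red _ _ L *m ((incl p S)^T *m Y *m incl p S) *m red _ _ R) => X.
  rewrite /phi (mulmxDr _ X) (mulmxDl _ _ (red _ _ (invmx R))) !mulmxA Lv mul1mx.
  rewrite -(mulmxA _ (red _ _ R)) Rv mulmx1 addrAC [in LHS]mulmxDr [in LHS]mulmxDl; congr (_ + _).
  have inclK : incl p S *m (incl p S)^T = 1%:M.
    by apply/matrixP=> a b; rewrite mul_inclT !mxE (inj_eq enum_val_inj) eq_sym.
  by rewrite !mulmxA inclK mul1mx -mulmxA inclK mulmx1.
congr (_ * _)%N; apply: eq_card => X; rewrite !inE.
set Xl := map_mx _ X.
have -> : A + (p ^ n)%N%:Z *: Xl =
    L *m (diag_mx dr + (p ^ n)%N%:Z *: (invmx L *m Xl *m invmx R)) *m R.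
  rewrite mulmxDr mulmxDl -AE -scalemxAr -scalemxAl; congr (_ + _ *: _).
  by rewrite !mulmxA mulmxV // mul1mx mulmxKV.
rewrite (card_levelker_mul p_pr n.+1 _ uLr uRr) (card_levelker_diag_add p_pr) -/S.
have -> : incl p S *m red _ _ (invmx L *m Xl *m invmx R + diag_mx (\row_j (dr 0%R j %/ (p ^
  n)%N%:Z)%Z)) *m (incl p S)^T = phi X.
  rewrite /phi /red map_mxD !map_mxM map_diag_mx red_lift.
  by [].
rewrite (inj_eq (expnI (prime_gt1 p_pr))).
by have := rank_leq_row (phi X); move: (\rank (phi X)) => r rs; apply/eqP/eqP; lia.
Qed.

(** * q-binomial identities and ranks over finite fields *)

Section QBinomial.
Variables (R : realType) (t : R).
Hypotheses (t_ge0 : 0 <= t) (t_lt1 : t < 1).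

Lemma qpochS (a q : R) n : qpoch a q n.+1 = qpoch a q n * (1 - a * q ^+ n).
Proof. by rewrite /qpoch big_ord_recr. Qed.

Lemma qpochSl (a q : R) n : qpoch a q n.+1 = (1 - a) * qpoch (a * q) q n.
Proof.
rewrite /qpoch big_ord_recl expr0 mulr1; congr (_ * _).
by apply: eq_bigr => i _; rewrite -mulrA -exprS.
Qed.

Lemma qpoch_gt0 (a : R) n : 0 <= a -> a < 1 -> 0 < qpoch a t n.
Proof.
move=> a0 a1; apply: prodr_gt0 => i _; rewrite subr_gt0.
by apply: le_lt_trans a1; rewrite ler_piMr // exprn_ile1 // ltW.
Qed.

(** The Gaussian binomial coefficient with parameter t, extended by 0 for r > m. *)
Definition qbin (m r : nat) : R :=
  if (r <= m)%N then qpoch t t m / (qpoch t t r * qpoch t t (m - r)) else 0.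

Lemma qbin0 m : qbin m 0 = 1.
Proof.
rewrite /qbin leq0n subn0 /qpoch big_ord0 mul1r divff // lt0r_neq0 //.
exact: qpoch_gt0.
Qed.

Lemma qbin_small m r : (m < r)%N -> qbin m r = 0.
Proof. by rewrite /qbin ltnNge; case: leqP. Qed.

Lemma qbinn m : qbin m m = 1.
Proof.
rewrite /qbin leqnn subnn /qpoch big_ord0 mulr1 divff // lt0r_neq0 //.
exact: qpoch_gt0.
Qed.

Let tt_neq0 n : qpoch t t n != 0.
Proof. by rewrite lt0r_neq0 // qpoch_gt0. Qed.

Let tS_neq0 n : 1 - t * t ^+ n != 0.
Proof. by have := tt_neq0 n.+1; rewrite qpochS mulf_eq0 negb_or => /andP[]. Qed.

Lemma qbinS m r : qbin m.+1 r.+1 = qbin m r.+1 + t ^+ (m - r) * qbin m r.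
Proof.
case: (ltngtP m r) => [mr|rm|->]; last first.
- by rewrite subnn !qbinn qbin_small // add0r mul1r.
- rewrite /qbin ltnS (ltnW rm) rm subSS.
  rewrite (_ : m - r = (m - r.+1).+1)%N; last by lia.
  rewrite !qpochS; set k := (m - r.+1)%N.
  have -> : t * t ^+ m = t * t ^+ r * (t * t ^+ k).
    by rewrite -!exprS -exprD; congr (_ ^+ _); rewrite /k; lia.
  rewrite exprS; field.
  by rewrite !tt_neq0 !tS_neq0.
- by rewrite !qbin_small ?mulr0 ?addr0 //; lia.
Qed.

Lemma qbinSr m r : qbin m.+1 r.+1 = t ^+ r.+1 * qbin m r.+1 + qbin m r.
Proof.
case: (ltngtP m r) => [mr|rm|->]; last first.
- by rewrite !qbinn qbin_small // mulr0 add0r.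
- rewrite /qbin ltnS (ltnW rm) rm subSS.
  rewrite (_ : m - r = (m - r.+1).+1)%N; last by lia.
  rewrite !qpochS; set k := (m - r.+1)%N.
  have -> : t * t ^+ m = t * t ^+ r * (t * t ^+ k).
    by rewrite -!exprS -exprD; congr (_ ^+ _); rewrite /k; lia.
  rewrite !exprS; field.
  by rewrite !tt_neq0 !tS_neq0.
- by rewrite !qbin_small ?mulr0 ?addr0 //; lia.
Qed.

(* Pascal's rule turns the sum for M + 1 into (1 - a b) times the sum for M
   with a replaced by a t. *)
Lemma q_vandermonde (a b : R) M :
  \sum_(y < M.+1) qbin M y * a ^+ y * (\prod_(i < y) (t ^+ i * (t ^+ i - b)))
     * qpoch (a * t ^+ y) t (M - y) = qpoch (a * b) t M.
Proof.
elim: M a => [|M IH] a.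
  by rewrite big_ord1 qbin0 /qpoch !big_ord0 !mul1r.
pose c y := \prod_(i < y) (t ^+ i * (t ^+ i - b)).
have cS y : c y.+1 = c y * (t ^+ y * (t ^+ y - b)) by rewrite /c big_ord_recr.
pose G y := qbin M y * (a * t) ^+ y * c y * qpoch (a * t * t ^+ y) t (M - y).
have -> : qpoch (a * b) t M.+1 = (1 - a * b) * \sum_(y < M.+1) G y.
  by rewrite IH qpochSl mulrAC.
rewrite mulr_sumr.
(* Pascal's rule splits each summand into an F1 term and, after a shift of index, an F2 term. Then
   F1 + F2 = (1 - a b) G term by term, because (1 - a t^y) + a (t^y - b) = 1 - a b. *)
pose F1 y := t ^+ y * qbin M y * a ^+ y * c y * qpoch (a * t ^+ y) t (M.+1 - y).
pose F2 y := qbin M y * a ^+ y.+1 * c y.+1 * qpoch (a * t ^+ y.+1) t (M - y).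
transitivity (\sum_(y < M.+1) F1 y + \sum_(y < M.+1) F2 y).
  have F10 : F1 M.+1 = 0 by rewrite /F1 qbin_small // mulr0 !mul0r.
  have -> : \sum_(y < M.+1) F1 y = \sum_(y < M.+2) F1 y.
    by rewrite [RHS]big_ord_recr /= F10 addr0.
  rewrite !(big_ord_recl M.+1) -addrA; congr (_ + _).
    by rewrite /F1 !qbin0 !expr0 !mul1r.
  rewrite -big_split; apply: eq_bigr => y _ /=.
  rewrite /F1 /F2 /bump /= add1n qbinSr subSS -/(c y.+1); ring.
rewrite -big_split; apply: eq_bigr => -[y /= yM] _.
rewrite /F1 /F2 /G cS subSn // qpochSl exprMn.
have -> : a * t ^+ y * t = a * t * t ^+ y by ring.
have -> : a * t ^+ y.+1 = a * t * t ^+ y by rewrite exprS mulrA.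
by rewrite exprS; ring.
Qed.
End QBinomial.

(** * Counting matrices of given rank over a finite field *)

Section RankCount.
Variables (F : finFieldType) (R : realType).
Local Notation q := (#|F|%:R : R).
Local Notation t := (q^-1).

Definition nrank m n r := #|[pred A : 'M[F]_(m, n) | \rank A == r]|.

Lemma rank_col_row m n (u : 'rV[F]_n) (A : 'M[F]_(m, n)) :
  \rank (col_mx u A) = (\rank A + ~~ (u <= A)%MS)%N.
Proof.
rewrite -addsmxE; case: (boolP (u <= A)%MS) => uA /=.
  by rewrite addn0 (addsmx_idPr uA).
rewrite addn1; apply/eqP; rewrite eqn_leq; apply/andP; split.
  apply: leq_trans (mxrank_adds_leqif u A) _.
  by have := rank_leq_row u; move: (\rank u) (\rank A) => r s; lia.
rewrite ltn_neqAle mxrankS ?addsmxSr // andbT.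
by rewrite (mxrank_leqif_sup (addsmxSr u A)) addsmx_sub negb_and uA.
Qed.

(** The first row keeps the rank of the other rows when it lies in their span, and raises it by one
    otherwise. *)
Lemma nrank_row m n r :
  nrank m.+1 n r.+1 = (#|F| ^ r.+1 * nrank m n r.+1 + (#|F| ^ n - #|F| ^ r) * nrank m n r)%N.
Proof.
have cardin k (A : 'M[F]_(m, n)) : \rank A = k -> #|[pred u :
  'rV[F]_n | (u <= A)%MS]| = (#|F| ^ k)%N.
  by move=> <-; rewrite -card_rowg; apply: eq_card => u; rewrite mem_rowg.
have cardout k (A : 'M[F]_(m, n)) : \rank A = k ->
    #|[pred u : 'rV[F]_n | ~~ (u <= A)%MS]| = (#|F| ^ n - #|F| ^ k)%N.
  move=> /cardin <-; have := cardC [pred u : 'rV[F]_n | (u <= A)%MS].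
  by rewrite card_mx mul1n => <-; rewrite addKn.
have colK : {on predT, bijective (fun uA : 'rV[F]_n * 'M[F]_(m, n) => col_mx uA.1 uA.2 :
  'M[F]_(1 + m, n))}.
  apply: onW_bij; exists (fun B : 'M[F]_(1 + m, n) => (usubmx B, dsubmx B)) => [[u A]|B] /=.
    by rewrite col_mxKu col_mxKd.
  by rewrite vsubmxK.
have nrE k : nrank m n k = (\sum_(A : 'M[F]_(m, n)) (\rank A == k))%N.
  by rewrite /nrank -sum1_card big_mkcond; apply: eq_bigr => A _; rewrite inE; case: eqP.
rewrite !nrE /nrank -sum1_card (reindex _ (subon_bij (fun _ _ => isT) colK)) /=.
rewrite (eq_bigl (fun uA : 'rV[F]_n * 'M[F]_(m, n) => (\rank uA.2 + ~~ (uA.1 <= uA.2)%MS ==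
  r.+1)%N));
  last by move=> uA; rewrite !inE -rank_col_row.
rewrite big_mkcond /= -(pair_bigA _ (fun (u : 'rV[F]_n) (A : 'M[F]_(m, n)) =>
  if (\rank A + ~~ (u <= A)%MS == r.+1)%N then 1%N else 0%N)) exchange_big /=.
rewrite !big_distrr -big_split /=.
apply: eq_bigr => A _; rewrite -big_mkcond /=.
case: (eqVneq (\rank A) r) => [Ar|Ar].
  rewrite Ar (ltn_eqF (ltnSn r)) muln0 add0n muln1 -(cardout _ _ Ar) -sum1_card.
  by apply: eq_bigl => u; rewrite !inE ?Ar; case: (u <= A)%MS;
    rewrite /= ?addn0 ?addn1 ?eqxx ?ltn_eqF.
rewrite muln0 addn0; case: (eqVneq (\rank A) r.+1) => [Ar1|Ar1].
  rewrite muln1 -(cardin _ _ Ar1) -sum1_card; apply: eq_bigl => u.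
  by rewrite !inE ?Ar1; case: (u <= A)%MS; rewrite /= ?addn0 ?addn1 ?eqxx // gtn_eqF.
rewrite muln0 big_pred0 // => u; case: (u <= A)%MS; rewrite /= ?addn0 ?addn1.
  exact: negbTE.
by rewrite eqSS; exact: negbTE.
Qed.

Lemma nrank0 m n : nrank m n 0 = 1%N.
Proof.
rewrite /nrank (eq_card (_ : _ =i pred1 0)) ?card1 // => A.
by rewrite !inE mxrank_eq0.
Qed.

Lemma nrank_0row n r : nrank 0 n r.+1 = 0%N.
Proof.
apply: eq_card0 => A; rewrite !inE.
by apply/eqP => rA; have := rank_leq_row A; rewrite rA.
Qed.

Lemma natr_card_gt1 : 1 < q.
Proof. by rewrite ltr1n card_finNzRing_gt1. Qed.

Lemma card_inv_ge0 : 0 <= t. Proof. by rewrite invr_ge0. Qed.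
Lemma card_inv_lt1 : t < 1.
Proof. by rewrite invf_lt1 ?natr_card_gt1 // (lt_trans ltr01 natr_card_gt1). Qed.

(** Induction on the number of rows, the recursion [nrank_row] being matched with the Pascal rule
    [qbinS]. Factoring out q^(m n) leaves the law of the rank of a uniform matrix. *)
Lemma nrankE m n r : (r <= n)%N ->
  (nrank m n r)%:R = q ^+ (m * n) * t ^+ ((m - r) * (n - r)) *
     (\prod_(i < r) (1 - t ^+ (n - i))) * qbin t m r.
Proof.
have q0 : q != 0 by rewrite lt0r_neq0 // (lt_trans ltr01 natr_card_gt1).
elim: m r => [|m IH] [|r] rn.
- by rewrite nrank0 big_ord0 (qbin0 card_inv_ge0 card_inv_lt1) mul0n !mul1r.
- by rewrite nrank_0row qbin_small // mulr0.
- rewrite nrank0 big_ord0 (qbin0 card_inv_ge0 card_inv_lt1) !subn0 exprVn !mulr1 divff //.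
  by rewrite expf_neq0.
rewrite nrank_row natrD !natrM IH // IH ?(ltnW rn) // (qbinS card_inv_ge0 card_inv_lt1).
rewrite natrB ?leq_pexp2l ?(ltnW rn) //; last by rewrite (cardD1 0).
rewrite !natrX big_ord_recr /= subSS mulSn exprD.
have qt k : q ^+ k * t ^+ k = 1 by rewrite -exprMn divff // expr1n.
have nr : (n = (n - r.+1) + r.+1)%N by rewrite subnK.
set d := (n - r.+1)%N in nr *.
have nrS : (n - r = d.+1)%N by rewrite /d; lia.
rewrite nrS; set P := \prod_(i < r) _.
have qn : q ^+ n = q ^+ d * q ^+ r.+1 by rewrite -exprD -nr.
rewrite [in RHS]mulrDr; congr (_ + _).
  (* For m <= r the subtraction m - r.+1 truncates and the exponent identity below may fail, but
     then the binomial coefficient is zero. *)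
  case: (leqP m r) => mr; first by rewrite qbin_small // !mulr0.
  have -> : ((m - r) * d = (m - r.+1) * d + d)%N by rewrite -mulSnr; congr (_ * _)%N; lia.
  rewrite exprD qn; set Q := q ^+ (m * _); set x := qbin _ _ _; set T := t ^+ (_ * d).
  transitivity (q ^+ r.+1 * Q * T * P * (1 - t ^+ d.+1) * x * (q ^+ d * t ^+ d)); last by ring.
  by rewrite qt; ring.
rewrite mulnS exprD qn exprS; set Q := q ^+ (m * _); set x := qbin _ _ _; set T := t ^+ (_ * d).
set T' := t ^+ (m - r).
transitivity (Q * (T' * T) * P * x * (q ^+ d * (q * q ^+ r) - (q * t) * (q ^+ d * t ^+ d) *
  q ^+ r)).
  by rewrite qt divff //; ring.
by rewrite exprS; ring.
Qed.
End RankCount.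

(** * The weights of the kernels and the total mass of pi_N *)

Section Weights.
Variables (R : realType) (p : nat).
Hypothesis p_pr : prime p.
Local Notation t := (qinv R p).

Lemma natr_prime_gt0 : 0 < p%:R :> R. Proof. by rewrite ltr0n prime_gt0. Qed.

Lemma qinv_ge0 : 0 <= t. Proof. by rewrite invr_ge0 ler0n. Qed.

Lemma qinv_lt1 : t < 1.
Proof. by rewrite invf_lt1 ?natr_prime_gt0 // ltr1n prime_gt1. Qed.

Lemma aS_ge0 (s : R) : 0 <= aS p s. Proof. exact: powR_ge0. Qed.

Lemma aS_lt1 (s : R) : -1 < s -> aS p s < 1.
Proof.
move=> s1; rewrite /aS /powR /pR gt_eqF ?natr_prime_gt0 // expR_lt1.
have : 0 < ln (p%:R : R) by rewrite ln_gt0 // ltr1n prime_gt1.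
by move=> l0; rewrite nmulr_rlt0 //; lra.
Qed.

Lemma aS0 : aS p 0 = t.
Proof. by rewrite /aS subr0 powR_inv1 // ler0n. Qed.

(** Rests on y^2 + s y = y (y - 1) + (1 + s) y. *)
Lemma weightE (s : R) (y : nat) :
  pR R p `^ (- (y%:R ^+ 2) - s * y%:R) = t ^+ (y * y.-1) * aS p s ^+ y.
Proof.
have p0 := natr_prime_gt0; have pn0 : pR R p != 0 by rewrite lt0r_neq0.
rewrite /qinv exprVn -powR_invn ?ler0n // /aS -(powR_mulrn y (powR_ge0 _ _)) -powRrM -powRD ?pn0
  ?implybT //.
congr (_ `^ _).
case: y => [|y] /=; first by ring.
by rewrite natrM -natr1; ring.
Qed.

Lemma qpoch_qinv_neq0 n : qpoch t t n != 0.
Proof. by rewrite lt0r_neq0 // qpoch_gt0 ?qinv_ge0 ?qinv_lt1. Qed.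

Lemma qpoch_aS_gt0 (s : R) n : -1 < s -> 0 < qpoch (aS p s) t n.
Proof. by move=> s1; rewrite qpoch_gt0 ?qinv_ge0 ?qinv_lt1 ?aS_ge0 ?aS_lt1. Qed.

Lemma qfallE n r : (r <= n)%N ->
  \prod_(i < r) (1 - t ^+ (n - i)) = qpoch t t n / qpoch t t (n - r).
Proof.
elim: r => [|r IH] rn; first by rewrite big_ord0 subn0 divff ?qpoch_qinv_neq0.
rewrite big_ord_recr /= IH ?(ltnW rn) //.
rewrite (_ : n - r = (n - r.+1).+1)%N; last by lia.
have := qpoch_qinv_neq0 (n - r.+1).+1; rewrite qpochS exprS => h.
have := h; rewrite mulf_eq0 negb_or => /andP[h1 h2]; field.
by rewrite h1 h2.
Qed.

(** This is [nrankE] for square matrices of rank w - c: the exponent of t becomes c^2, and the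
    remaining q-Pochhammer quotients are those of P^(0). *)
Lemma card_corank w c :
  #|[pred Y : 'M['F_p]_w | (\rank Y + c == w)%N]|%:R = (p ^ (w * w))%:R * Pker p (0 : R) w c.
Proof.
rewrite /Pker; case: leqP => cw; last first.
  rewrite mulr0 eq_card0 // => Y; rewrite !inE; apply/eqP => rc.
  by move: cw; rewrite -rc ltnNge leq_addl.
have -> : #|[pred Y : 'M['F_p]_w | (\rank Y + c == w)%N]| = nrank 'F_p w w (w - c)%N.
  by apply: eq_card => Y; rewrite !inE; move: (\rank Y) => r; apply/eqP/eqP; lia.
rewrite nrankE ?leq_subr // card_Fp // -/(qinv R p) weightE aS0 qfallE ?leq_subr // natrX.
rewrite /qbin leq_subr subKn // -exprD.
have -> : (c * c.-1 + c = c * c)%N by case: c {cw} => // c /=; lia.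
have hc := qpoch_qinv_neq0 c; have hw := qpoch_qinv_neq0 (w - c); field.
by rewrite hc hw.
Qed.

Lemma piN_ge0 N (s : R) x : -1 < s -> 0 <= piN p N s x.
Proof.
move=> s1; rewrite /piN mulr_ge0 ?powR_ge0 // divr_ge0 //.
  by rewrite mulr_ge0 // sqr_ge0.
by rewrite !mulr_ge0 ?sqr_ge0 // ltW // ?qpoch_aS_gt0 // qpoch_gt0 ?qinv_ge0 ?qinv_lt1.
Qed.

Lemma qpochD (a q : R) m n : qpoch a q (m + n) = qpoch a q m * qpoch (a * q ^+ m) q n.
Proof.
elim: n => [|n IH]; first by rewrite addn0 [qpoch _ _ 0]/qpoch big_ord0 mulr1.
by rewrite addnS !qpochS IH exprD !mulrA.
Qed.

(** With x = N - y this is the q-Vandermonde sum for a = p^{-1-s} and b = t^N; this b turns the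
    product of the t^i (t^i - b) into t^{y(y-1)} (t;t)_N / (t;t)_{N-y}. *)
Lemma sum_piN N (s : R) : -1 < s -> \sum_(x < N.+1) piN p N s x = 1.
Proof.
move=> s1; set a := aS p s.
have qa n : qpoch a t n != 0 by rewrite lt0r_neq0 // qpoch_aS_gt0.
pose b := t ^+ N.
have shift n k : qpoch (a * t ^+ n) t k = qpoch a t (n + k) / qpoch a t n.
  by rewrite qpochD mulrAC divff ?mul1r.
transitivity (qpoch a t N / qpoch (a * b) t N / qpoch a t N * \sum_(y < N.+1) qbin t N y *
  a ^+ y * (\prod_(i < y) (t ^+ i * (t ^+ i - b)))
     * qpoch (a * t ^+ y) t (N - y)); last first.
  rewrite (q_vandermonde qinv_ge0 qinv_lt1) shift; field.
  by rewrite !qa.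
rewrite mulr_sumr (reindex_inj rev_ord_inj); apply: eq_bigr => -[y /= yN] _.
rewrite /piN subSS subKn // weightE -/a (shift y) subnKC // [qpoch (a * b) t N](shift N).
have -> : \prod_(i < y) (t ^+ i * (t ^+ i - b)) =
    t ^+ (y * y.-1) * (qpoch t t N / qpoch t t (N - y)).
  rewrite -qfallE //; elim: y {shift} yN => [|y IH] yN; first by rewrite !big_ord0 mulr1.
  rewrite !big_ord_recr /= IH ?(ltnW yN) // [(y.+1 * y)%N](_ : _ = y * y.-1 + y + y)%N; last first.
    by case: y {IH yN} => //= y; lia.
  rewrite !exprD /b (_ : t ^+ N = t ^+ y * t ^+ (N - y)); first by ring.
  by rewrite -exprD subnKC // ltnW.
rewrite /qbin -ltnS yN mul2n -addnn.
have := qpoch_qinv_neq0 y; have := qpoch_qinv_neq0 (N - y); have := qa y => h1 h2 h3; field.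
by rewrite !qa !qpoch_qinv_neq0.
Qed.
End Weights.

(** * Digit expansions and the measure of level sets *)

Section NatFloor.
Variable R : realType.

Definition nfloor (x : R) : nat := `|Num.floor x|%N.

Lemma nfloorE (x : R) : 0 <= x -> (nfloor x)%:R = (Num.floor x)%:~R :> R.
Proof. by move=> x0; rewrite pmulrn /nfloor gez0_abs // floor_ge0. Qed.

Lemma nfloor_itv (x : R) : 0 <= x -> (nfloor x)%:R <= x < (nfloor x)%:R + 1.
Proof. by move=> x0; rewrite nfloorE //; have := floor_itv x; rewrite intrD. Qed.

Lemma nfloor_def (x : R) k : k%:R <= x < k%:R + 1 -> nfloor x = k.
Proof.
by move=> kx; rewrite /nfloor (@floor_def _ _ k%:Z) // intrD -!pmulrn.
Qed.

Lemma nfloor_div (x : R) d : 0 <= x -> (0 < d)%N -> nfloor (x / d%:R) = (nfloor x %/ d)%N.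
Proof.
move=> x0 d0; have dR : 0 < d%:R :> R by rewrite ltr0n.
have /andP[h1 h2] := nfloor_itv x0.
apply: nfloor_def; rewrite ler_pdivlMr // ltr_pdivrMr // natr1 -!natrM.
set k := nfloor x in h1 h2 *.
rewrite (le_trans _ h1) ?ler_nat ?leq_divM //= (lt_le_trans h2) //.
by rewrite natr1 ler_nat ltn_ceil.
Qed.

Lemma nfloor_frac (x : R) d : 0 <= x ->
  nfloor (x * d%:R) = (nfloor x * d + nfloor ((x - (Num.floor x)%:~R) * d%:R))%N.
Proof.
move=> x0; rewrite -nfloorE //.
have /andP[h1 h2] := nfloor_itv x0.
have y0 : 0 <= (x - (nfloor x)%:R) * d%:R by rewrite mulr_ge0 ?subr_ge0.
have /andP[h3 h4] := nfloor_itv y0.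
apply: nfloor_def; rewrite natrD natrM.
set f := (nfloor (_ * _))%:R in h3 h4 *.
by apply/andP; split; lra.
Qed.

(** Removing the integer part of x changes the scaled floor by a multiple of d, hence of k. *)
Lemma nfloor_mod (x : R) d k : 0 <= x -> (k %| d)%N ->
  (nfloor ((x - (Num.floor x)%:~R) * d%:R) %% k = nfloor (x * d%:R) %% k)%N.
Proof.
by move=> x0 /dvdnP[e ->]; rewrite (nfloor_frac _ x0) mulnA modnMDl.
Qed.

(** The set is the union of the intervals [j h, (j+1) h) with j < J selected by [g]; the induction
    splits off the last one. *)
Lemma lebesgue_nfloor (h : R) (g : nat -> bool) J : 0 < h ->
  let A := [set x : R | 0 <= x < J%:R * h /\ g (nfloor (x / h))] in
  measurable A /\
  (@lebesgue_measure R A = (h * (\sum_(j < J) g j)%:R)%:E)%E.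
Proof.
move=> h0; elim: J => [|J [mA muA]] A.
  have -> : A = set0.
    by rewrite -subset0 => x [/andP[x0]]; rewrite mul0r ltNge x0.
  by rewrite big_ord0 mulr0 measure0; split.
set B := [set x : R | _] in mA muA.
pose C := if g J then `[J%:R * h, J.+1%:R * h[%classic else set0.
have mC : measurable C by rewrite /C; case: (g J).
have AE : A = B `|` C.
  apply/seteqP; split=> x; rewrite /A /B /C /=.
    move=> [/andP[x0 xJ] gx]; case: (ltP x (J%:R * h)) => [xJ'|Jx].
      by left; rewrite x0.
    right; have xh : nfloor (x / h) = J.
      by apply: nfloor_def; rewrite ler_pdivlMr // ltr_pdivrMr // Jx /= natr1.
    by move: gx; rewrite xh => ->; rewrite /= in_itv /= Jx.
  move=> [[/andP[x0 xJ] gx]|].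
    by rewrite x0 (lt_trans xJ) // ltr_pM2r // ltr_nat.
  case gJ : (g J) => //=; rewrite in_itv /= => /andP[Jx xJ].
  have x0 : 0 <= x by rewrite (le_trans _ Jx) // mulr_ge0 // ltW.
  rewrite x0 xJ; split=> //.
  have -> // : nfloor (x / h) = J.
  by apply: nfloor_def; rewrite ler_pdivlMr // ltr_pdivrMr // Jx /= natr1.
have BC : [disjoint B & C].
  apply/disj_setPS => x [[/andP[_ xJ] _]]; rewrite /C; case: (g J) => //=.
  by rewrite in_itv /= leNgt xJ.
have muC : (lebesgue_measure C = (h * (g J)%:R)%:E)%E.
  rewrite /C; case: (g J); last by rewrite measure0 mulr0.
  rewrite lebesgue_measure_itv /= lte_fin ltr_pM2r // ltr_nat ltnSn -EFinB -mulrBl.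
  by rewrite -natrB // subSnn mul1r mulr1.
split; first by rewrite AE; exact: measurableU.
rewrite AE measureU //; last exact/disj_set2P.
rewrite [X in (X + _)%E]muA [X in (_ + X)%E]muC big_ord_recr natrD mulrDr EFinD.
by [].
Qed.
End NatFloor.

(** * Blocks of base-p digits and matrices modulo p^n *)

Lemma sum_nat_mul (a b : nat) (F : nat -> nat) :
  (\sum_(X < a * b) F X = \sum_(X < a) \sum_(Y < b) F (X * b + Y))%N.
Proof.
rewrite -(big_mkord xpredT F) big_nat_mul big_mkord; apply: eq_bigr => X _.
rewrite -{1}[(X * b)%N]add0n big_addn mulSn addnK big_mkord.
by apply: eq_bigr => Y _; rewrite addnC.
Qed.

Lemma digits_inj p k X Y : (0 < p)%N -> (X < p ^ k)%N -> (Y < p ^ k)%N ->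
  (forall i, (i < k)%N -> (X %/ p ^ i) %% p = (Y %/ p ^ i) %% p)%N -> X = Y.
Proof.
move=> p0; elim: k X Y => [|k IH] X Y; first by rewrite expn0 !ltnS !leqn0 => /eqP-> /eqP->.
rewrite !expnSr => Xk Yk XY.
rewrite (divn_eq X p) (divn_eq Y p).
have := XY 0%N isT; rewrite expn0 !divn1 => ->; congr (_ * _ + _)%N.
apply: IH; rewrite ?ltn_divLR // => i ik.
by rewrite -!divnMA -expnS XY.
Qed.

Lemma index_lt N (a b : 'I_N) : (a * N + b < N ^ 2)%N.
Proof.
case: a b => [a aN] [b bN] /=; rewrite -mulnn; apply: leq_trans (_ : a.+1 * N <= _)%N.
  by rewrite mulSn; lia.
by rewrite leq_mul2r aN orbT.
Qed.

Lemma index_surj N i : (i < N ^ 2)%N -> exists a b : 'I_N, (a * N + b)%N = i.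
Proof.
rewrite -mulnn; case: (posnP N) => [->|N0] iN; first by rewrite muln0 in iN.
have h1 : (i %/ N < N)%N by rewrite ltn_divLR.
by exists (Ordinal h1), (Ordinal (ltn_pmod i N0)); exact/esym/divn_eq.
Qed.

Section Slots.
Variables N m : nat.

(* Position, within a block of N^2 base-p digits, of the digit that [phi] sends
   to the entry (a, b): the digits after the radix point are dealt out starting
   from the most significant one, hence the reversal for n >= m. *)
Definition slot (n a b : nat) : nat :=
  if (n < m)%N then (a * N + b)%N else (N ^ 2 - (a * N + b).+1)%N.

Lemma slot_lt n (a b : 'I_N) : (slot n a b < N ^ 2)%N.
Proof.
rewrite /slot; case: ifP => _; first exact: index_lt.
by have := index_lt a b; lia.
Qed.

Lemma slot_surj n i : (i < N ^ 2)%N -> exists a b : 'I_N, slot n a b = i.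
Proof.
move=> iN; rewrite /slot; case: (n < m)%N; first exact: index_surj.
have [|a [b ab]] := @index_surj N (N ^ 2 - i.+1)%N; first by lia.
by exists a, b; rewrite ab; lia.
Qed.
End Slots.

Section Digits.
Variables (p N m : nat).
Local Notation slot := (slot N m).
Hypothesis p_pr : prime p.
Let p0 : (0 < p)%N := prime_gt0 p_pr.

Definition digmx n X : 'M[int]_N := \matrix_(a, b) ((X %/ p ^ slot n a b) %% p)%N%:Z.

Lemma digmxD n X Y : digmx n (X * p ^ (N ^ 2) + Y) = digmx n Y.
Proof.
apply/matrixP=> a b; rewrite !mxE; congr (_%:Z).
have sl := slot_lt m n a b.
have -> : (p ^ (N ^ 2) = p ^ (N ^ 2 - (slot n a b).+1) * p * p ^ slot n a b)%N.
  by rewrite -expnSr -expnD; congr (_ ^ _)%N; lia.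
by rewrite mulnA divnMDl ?expn_gt0 ?p0 // mulnA modnMDl.
Qed.

(** Among the n blocks of X, the most significant one is the coefficient of p^0 and the last one
    that of p^{n-1}, because [phi] stores lower p-adic positions in more significant digits. *)
Fixpoint amat (n X : nat) : 'M[int]_N :=
  if n is n'.+1 then amat n' (X %/ p ^ (N ^ 2))%N + (p ^ n')%N%:Z *: digmx n' X else 0.

Lemma amatS n X Y : (Y < p ^ (N ^ 2))%N ->
  amat n.+1 (X * p ^ (N ^ 2) + Y) = amat n X + (p ^ n)%N%:Z *: digmx n Y.
Proof.
move=> Yp; rewrite /= digmxD; congr (amat _ _ + _).
by rewrite divnMDl ?expn_gt0 ?p0 // divn_small ?addn0.
Qed.

(** A block of N^2 digits and a matrix over F_p carry the same data: the map is injective by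
    uniqueness of digits, and the cardinalities agree. *)
Lemma sum_digmx n (f : 'M[int]_N -> nat) :
  (\sum_(Y < p ^ (N ^ 2)) f (digmx n Y) =
   \sum_(Z : 'M['F_p]_N) f (map_mx (fun x : 'F_p => (x : nat)%:Z) Z))%N.
Proof.
pose h (Y : 'I_(p ^ (N ^ 2))) : 'M['F_p]_N := \matrix_(a, b) ((Y %/ p ^ slot n a b) %% p)%N%:R.
have hval Y a b : (h Y a b : nat) = ((Y %/ p ^ slot n a b) %% p)%N.
  by rewrite mxE val_Fp_nat // modn_mod.
have hinj : injective h.
  move=> X Y hXY; apply/val_inj/(digits_inj p0 (ltn_ord X) (ltn_ord Y)) => i ik.
  by have [a [b <-]] := slot_surj m n ik; rewrite -!hval hXY.
have hbij : bijective h.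
  by apply: (inj_card_bij hinj); rewrite card_mx card_Fp // card_ord mulnn.
rewrite [RHS](reindex h) /=; last exact: onW_bij.
by apply: eq_bigr => Y _; congr f; apply/matrixP=> a b; rewrite [LHS]mxE [RHS]mxE hval.
Qed.

Variable w : nat -> nat.

Fixpoint good (n X : nat) : bool :=
  if n is n'.+1 then
    good n' (X %/ p ^ (N ^ 2))%N && (#|levelker p n (amat n X)| == p ^ w n)%N
  else true.

Lemma card_levelker0 (A : 'M[int]_N) : #|levelker p 0 A| = (p ^ N)%N.
Proof.
rewrite (_ : A = diag_mx 0 + (p ^ 0)%N%:Z *: A); last by rewrite expn0 scale1r raddf0 add0r.
rewrite levelker_eqmod (card_levelker_diag p_pr) (_ :
  dvdset _ _ _ = [set: 'I_N]%SET) ?cardsT ?card_ord //.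
by apply/setP=> j; rewrite !inE mxE dvdz0.
Qed.

Hypothesis w0 : w 0%N = N.

Lemma good_card n X : good n X -> #|levelker p n (amat n X)| = (p ^ w n)%N.
Proof. by case: n => [_|n /andP[_ /eqP]] //; rewrite card_levelker0 w0. Qed.

(** Appending a block to a good X is a uniform choice of the next digit matrix, so by
    [card_levelker_lift] and [card_corank] it multiplies the count by p^{N^2} P^(0)(w_n,
    w_{n+1}). *)
Lemma count_good (R : realType) n :
  (\sum_(X < p ^ (n * N ^ 2)) good n X)%:R =
  (p ^ (n * N ^ 2))%:R * \prod_(i < n) Pker p (0 : R) (w i) (w i.+1).
Proof.
elim: n => [|n IH]; first by rewrite mul0n expn0 big_ord1 big_ord0 mulr1.
have pw0 k : (p ^ k)%:R != 0 :> R by rewrite pnatr_eq0 -lt0n expn_gt0 p0.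
rewrite mulSnr expnD (sum_nat_mul _ _ (fun X => good n.+1 X)) big_ord_recr /=.
set P := Pker p 0 _ _.
have inner (X : nat) : (\sum_(Y < p ^ (N ^ 2)) good n.+1 (X * p ^ (N ^ 2) + Y))%:R =
    (p ^ (N ^ 2))%:R * P * (good n X)%:R.
  case gX : (good n X); last first.
    rewrite mulr0 big1 // => Y _.
    by rewrite /= divnMDl ?expn_gt0 ?p0 // divn_small ?addn0 // gX.
  pose f (Z : 'M[int]_N) : nat := (#|levelker p n.+1 (amat n X + (p ^ n)%N%:Z *: Z)| == p ^ w
    n.+1)%N.
  have -> : (\sum_(Y < p ^ (N ^ 2)) good n.+1 (X * p ^ (N ^ 2) + Y) =
             \sum_(Y < p ^ (N ^ 2)) f (digmx n Y))%N.
    apply: eq_bigr => Y _; rewrite /f -amatS //.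
    by rewrite /= divnMDl ?expn_gt0 ?p0 // divn_small ?addn0 // gX.
  (* The lifting count is stated without division; its factor p^{w_n^2} is cancelled here. *)
  rewrite sum_digmx mulr1; apply: (mulIf (pw0 (w n * w n)%N)).
  have := card_levelker_lift p_pr (w n.+1) (good_card gX).
  move=> /(congr1 (fun k => k%:R : R)); rewrite !natrM card_corank // -/P mulnn => cl.
  rewrite mulrAC -[RHS]mulrA -cl; congr (_ * _); rewrite -sum1_card [in RHS]big_mkcond.
  by congr (_%:R); apply: eq_bigr => Z _; rewrite inE /f; case: eqP.
rewrite natr_sum (eq_bigr (fun X : 'I__ => (p ^ (N ^ 2))%:R * P * (good n X)%:R));
  last by move=> X _; exact: inner.
rewrite -mulr_sumr -natr_sum IH natrM; ring.
Qed.

(* The block of digits of x ending at p^{(m-n) N^2} encodes p^m Z mod p^n. *)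
Definition event (R : realType) n : set R :=
  [set x : R | 0 <= x < (p ^ (m * N ^ 2))%:R /\
     good n (nfloor (x * (p ^ (n * N ^ 2))%:R / (p ^ (m * N ^ 2))%:R))].

Lemma event_measure (R : realType) n :
  measurable (@event R n) /\
  (lebesgue_measure (@event R n) =
   ((p ^ (m * N ^ 2))%:R * \prod_(i < n) Pker p (0 : R) (w i) (w i.+1))%:E)%E.
Proof.
have pw0 k : 0 < (p ^ k)%:R :> R by rewrite ltr0n expn_gt0 p0.
pose h : R := (p ^ (m * N ^ 2))%:R / (p ^ (n * N ^ 2))%:R.
have h0 : 0 < h by rewrite divr_gt0.
have [mA muA] := lebesgue_nfloor (good n) (p ^ (n * N ^ 2)) h0.
set A := [set x | _] in mA muA.
have -> : @event R n = A.
  have hn : (p ^ (n * N ^ 2))%:R * h = (p ^ (m * N ^ 2))%:R.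
    by rewrite /h mulrC divfK // lt0r_neq0.
  by apply/seteqP; split=> x; rewrite /event /A /= hn /h invf_div -mulrA.
split=> //; rewrite muA count_good /h; congr (_%:E); field.
by rewrite lt0r_neq0.
Qed.

End Digits.

Definition resmx (p N n m : nat) (Z : qpmat N) : 'M[int]_N :=
  \matrix_(a, b) resq p n m (Z a b).

(** Says that p^m Z is integral. *)
Definition vanishes_below (N m : nat) (Z : qpmat N) : Prop :=
  forall a b (j : int), j < - m%:Z -> Z a b j = 0%N.

(** * Reading the digits of Z off a real number *)

Section PhiDigits.
Variables (R : realType) (p N : nat).
Hypothesis p_pr : prime p.
Let p0 : (0 < p)%N := prime_gt0 p_pr.
Let pw0 k : 0 < (p ^ k)%:R :> R.
Proof. by rewrite ltr0n expn_gt0 p0. Qed.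

Lemma phi_lt (x : R) a b j : (@phi R p N x a b j < p)%N.
Proof. by rewrite /phi; case: j => i; rewrite ltn_pmod. Qed.

(** For n < m the position n - m is negative and its digit comes from the integer part of x.
    Otherwise it comes from the fractional part, where restoring the integer part is invisible
    modulo p. *)
Lemma phi_digit m n (x : R) (a b : 'I_N) : 0 <= x ->
  @phi R p N x a b (n%:Z - m%:Z) =
  ((nfloor (x * (p ^ (n.+1 * N ^ 2))%:R / (p ^ (m * N ^ 2))%:R) %/ p ^ slot N m n a b) %% p)%N.
Proof.
move=> x0; have tN := index_lt a b; set t := (a * N + b)%N in tN *.
rewrite -nfloor_div ?expn_gt0 ?p0 //; last by rewrite divr_ge0 ?mulr_ge0 // ltW.
rewrite /slot -/t; case: (ltnP n m) => nm.
  have -> : n%:Z - m%:Z = Negz (m - n.+1) by rewrite NegzE; lia.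
  rewrite /phi -/t -/(nfloor x) -nfloor_div ?expn_gt0 ?p0 //.
  congr (nfloor _ %% _)%N.
  have -> : (p ^ ((m - n.+1) * N ^ 2 + t))%:R = (p ^ (m * N ^ 2))%:R * (p ^ t)%:R / (p ^ (n.+1 *
    N ^ 2))%:R :> R.
    apply: (mulIf (lt0r_neq0 (pw0 (n.+1 * N ^ 2)))); rewrite divfK ?lt0r_neq0 //.
    rewrite -!natrM -!expnD; congr (_ ^ _)%:R.
    by rewrite addnAC -mulnDl subnK.
  field; by rewrite !lt0r_neq0.
have -> : n%:Z - m%:Z = Posz (n - m) by lia.
rewrite /phi -/t -/(nfloor _) /pR -natrX nfloor_mod //; last by rewrite expnS dvdn_mulr.
congr (nfloor _ %% _)%N.
have -> : (p ^ (n.+1 * N ^ 2))%:R = (p ^ ((n - m) * N ^ 2 + t).+1)%:R * (p ^ (m * N ^ 2))%:R *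
  (p ^ (N ^ 2 - t.+1))%:R :> R.
  rewrite -!natrM -!expnD; congr (_ ^ _)%:R.
  rewrite mulSn -{1}(subnK nm) mulnDl; lia.
by field; rewrite !lt0r_neq0.
Qed.

Lemma amat_phi m n (x : R) : 0 <= x ->
  amat p N m n (nfloor (x * (p ^ (n * N ^ 2))%:R / (p ^ (m * N ^ 2))%:R)) =
  resmx p n m (@phi R p N x).
Proof.
move=> x0; elim: n => [|n IH].
  by apply/matrixP=> a b; rewrite !mxE /resq big_ord0.
rewrite /= -nfloor_div ?expn_gt0 ?p0 //; last by rewrite divr_ge0 ?mulr_ge0 // ltW.
set y := x * _ / _.
have -> : y / (p ^ (N ^ 2))%:R = x * (p ^ (n * N ^ 2))%:R / (p ^ (m * N ^ 2))%:R.
  by rewrite /y mulSn expnD natrM; field; rewrite !lt0r_neq0.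
rewrite IH; apply/matrixP=> a b; rewrite !mxE /resq big_ord_recr /= PoszD PoszM.
by rewrite phi_digit // mulrC.
Qed.

(** Positions below -m hold the digits of the integer part of x from index m N^2 on, so they vanish
    exactly when x < p^{m N^2}. For N = 0 there are no entries, whence the guard. *)
Lemma vanishes_phi m (x : R) : 0 <= x ->
  vanishes_below m (@phi R p N x) <-> ((0 < N)%N -> x < (p ^ (m * N ^ 2))%:R).
Proof.
move=> x0; have /andP[fx xf] := nfloor_itv x0; split=> [V N0|xm a b j jm].
  have : (nfloor x %/ p ^ (m * N ^ 2) = 0)%N.
    set Y := (_ %/ _)%N.
    (* [Y] is compared with 0 on its first [Y] digits, which are enough since Y < p^Y. *)
    apply: (@digits_inj p Y) => //; first exact: ltn_expl (prime_gt1 p_pr).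
      by rewrite expn_gt0 p0.
    move=> i _; rewrite div0n mod0n /Y -divnMA -expnD.
    have Q0 : (0 < N ^ 2)%N by rewrite expn_gt0 N0.
    have [a [b ab]] := index_surj (ltn_pmod i Q0).
    have /(V a b) : Negz (i %/ N ^ 2 + m) < - m%:Z by rewrite NegzE ltrN2 ltz_nat ltnS leq_addl.
    rewrite /phi ab -/(nfloor x) mulnDl addnAC -divn_eq.
    by rewrite addnC.
  move/eqP; rewrite -leqn0 leqNgt divn_gt0 ?expn_gt0 ?p0 // -ltnNge => xm.
  by apply: (lt_le_trans xf); rewrite natr1 ler_nat.
case: j jm => [i|i] im; first by lia.
have mi : (m <= i)%N by move: im; rewrite NegzE; lia.
rewrite /phi -/(nfloor x).
have N0 : (0 < N)%N by case: N a => // -[].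
rewrite divn_small ?mod0n // -(ltr_nat R) (le_lt_trans fx) // (lt_le_trans (xm N0)) //.
rewrite ler_nat leq_pexp2l //; apply: (@leq_trans (i * N ^ 2)); last exact: leq_addr.
by rewrite leq_mul2r mi orbT.
Qed.

Lemma vanishes_phi_ex (x : R) : 0 <= x -> exists m, vanishes_below m (@phi R p N x).
Proof.
move=> x0; exists (nfloor x).+1; apply/(vanishes_phi _ x0) => N0.
have /andP[_ xf] := nfloor_itv x0; apply: (lt_le_trans xf); rewrite natr1 ler_nat.
apply: leq_trans (ltnW (ltn_expl _ (prime_gt1 p_pr))) _.
by rewrite leq_pexp2l // leq_pmulr // expn_gt0 N0.
Qed.

(** Dropping the last block of the number read at level n + 1 leaves the number read at level n, so
    the conditions nest. *)
Lemma eventE m w n (x : R) : (0 < N)%N -> w 0%N = N ->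
  event p N m w n x <-> [/\ 0 <= x, vanishes_below m (@phi R p N x) &
    forall i, (i <= n)%N -> #|levelker p i (resmx p i m (@phi R p N x))| = (p ^ w i)%N].
Proof.
move=> N0 w0.
have goodE : 0 <= x -> good p N m w n (nfloor (x * (p ^ (n * N ^ 2))%:R / (p ^ (m * N ^ 2))%:R)) <->
  forall i, (i <= n)%N -> #|levelker p i (resmx p i m (@phi R p N x))| = (p ^ w i)%N.
  move=> x0; elim: n => [|n IH].
    by split=> // _ i; rewrite leqn0 => /eqP ->; rewrite card_levelker0 // w0.
  have e : (nfloor (x * (p ^ (n.+1 * N ^ 2))%:R / (p ^ (m * N ^ 2))%:R) %/ p ^ N ^ 2)%N =
      nfloor (x * (p ^ (n * N ^ 2))%:R / (p ^ (m * N ^ 2))%:R).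
    rewrite -nfloor_div ?expn_gt0 ?p0 //; last by rewrite divr_ge0 ?mulr_ge0 // ltW.
    by congr nfloor; rewrite mulSn expnD natrM; field; rewrite !lt0r_neq0.
  have -> : good p N m w n.+1 (nfloor (x * (p ^ (n.+1 * N ^ 2))%:R / (p ^ (m * N ^ 2))%:R)) =
     good p N m w n (nfloor (x * (p ^ (n * N ^ 2))%:R / (p ^ (m * N ^ 2))%:R)) &&
      (#|levelker p n.+1 (resmx p n.+1 m (@phi R p N x))| == p ^ w n.+1)%N.
    by rewrite -amat_phi // -e.
  split=> [/andP[/IH h /eqP h'] i|h].
    by rewrite leq_eqVlt => /orP[/eqP -> //|]; exact: h.
  by apply/andP; split; [apply/IH => i ni; apply/h/leqW|apply/eqP/h].
split=> [[/andP[x0 xm] /(goodE x0)]|[x0 /(vanishes_phi _ x0) xm /(goodE x0) g]].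
  by move=> g; split=> //; apply/(vanishes_phi _ x0).
by split=> //; rewrite x0 xm.
Qed.
End PhiDigits.

(** * Congruences and singular numbers *)

Lemma card_le_extE N (k : sing_t N) c : cnt_le k c = #|[set t : 'I_N | le_ext (k t) (Some c)]%SET|.
Proof. by rewrite /cnt_le; apply: eq_card => t; rewrite !inE; apply/asboolP/idP. Qed.

Definition bounded_by N m (k : sing_t N) := forall i, le_ext (k i) (Some m%:Z).

Lemma vanishes_belowD N m e (Z : qpmat N) : vanishes_below m Z -> vanishes_below (m + e) Z.
Proof. by move=> V a b j jm; apply: V; lia. Qed.

Lemma bounded_byD N m e (k : sing_t N) : bounded_by m k -> bounded_by (m + e) k.
Proof. by move=> W i; have := W i; case: (k i) => //= a; lia. Qed.

Section EqMod.
Variables p N : nat.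
Local Notation pz n := ((p ^ n)%N%:Z).

Definition eqm n (A B : 'M[int]_N) := exists E, A = B + pz n *: E.

Lemma eqm_dvd n A B : eqm n A B <-> forall a b, (pz n %| A a b - B a b)%Z.
Proof.
split=> [[E ->] a b|h].
  by rewrite !mxE addrAC subrr add0r dvdz_mulr.
exists (\matrix_(a, b) ((A a b - B a b)%R %/ pz n)%Z); apply/matrixP=> a b.
by rewrite !mxE mulrC divzK // addrC subrK.
Qed.

Lemma eqm_refl n A : eqm n A A.
Proof. by exists 0; rewrite scaler0 addr0. Qed.

Lemma eqm_sym n A B : eqm n A B -> eqm n B A.
Proof. by case=> E ->; exists (- E); rewrite scalerN addrK. Qed.

Lemma eqm_trans n B A C : eqm n A B -> eqm n B C -> eqm n A C.
Proof. by case=> E -> [F ->]; exists (F + E); rewrite scalerDr addrA. Qed.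

Lemma eqm_mul n A B A' B' : eqm n A A' -> eqm n B B' -> eqm n (A *m B) (A' *m B').
Proof.
case=> E -> [F ->]; exists (E *m B' + A' *m F + pz n *: (E *m F)).
rewrite mulmxDl !mulmxDr -!scalemxAl -!scalemxAr !scalerDr -addrA; congr (_ + _).
by rewrite addrCA addrA.
Qed.

Lemma eqm_down n A B : eqm n.+1 A B -> eqm n A B.
Proof.
by case=> E ->; exists (p%:Z *: E); rewrite scalerA -PoszM expnSr.
Qed.

Lemma eqm_levelker n A B : eqm n A B -> levelker p n A = levelker p n B.
Proof. by case=> E ->; rewrite levelker_eqmod. Qed.

Definition zpmx n (B : zpmat N) : 'M[int]_N := \matrix_(a, b) res p n (B a b).

Lemma zpmxS n B : eqm n (zpmx n.+1 B) (zpmx n B).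
Proof.
exists (\matrix_(a, b) (B a b n)%:Z); apply/matrixP=> a b.
by rewrite !mxE /res big_ord_recr /= PoszD PoszM [in RHS]mulrC.
Qed.

Lemma eqm_downD n e (A B : 'M[int]_N) : eqm (e + n) A B -> eqm n A B.
Proof. by elim: e => // e IH; rewrite addSn => /eqm_down. Qed.

Lemma eqm_tower (A : nat -> 'M[int]_N) : (forall n, eqm n (A n.+1) (A n)) ->
  forall n e, eqm n (A (e + n)%N) (A n).
Proof.
move=> AS n e; elim: e => [|e IH]; first exact: eqm_refl.
by apply: eqm_trans IH; rewrite addSn; apply: (@eqm_downD _ e); exact: AS.
Qed.

Lemma zpmxD n e B : eqm n (zpmx (e + n) B) (zpmx n B).
Proof. by apply: (eqm_tower (A := zpmx^~ B)) => i; exact: zpmxS. Qed.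

Lemma resmxS n m (Z : qpmat N) : eqm n (resmx p n.+1 m Z) (resmx p n m Z).
Proof.
exists (\matrix_(a, b) (Z a b (n%:Z - m%:Z))%:Z); apply/matrixP=> a b.
by rewrite !mxE /resq big_ord_recr /= PoszD PoszM [in RHS]mulrC.
Qed.

Lemma resmx_tower n m e (Z : qpmat N) : eqm n (resmx p (e + n) m Z) (resmx p n m Z).
Proof. by apply: (eqm_tower (A := fun i => resmx p i m Z)) => i; exact: resmxS. Qed.

Lemma isGLE B : isGL p B <->
  (forall a b j, (B a b j < p)%N) /\
  exists C : zpmat N, (forall a b j, (C a b j < p)%N) /\
   forall n, eqm n (zpmx n B *m zpmx n C) 1%:M /\ eqm n (zpmx n C *m zpmx n B) 1%:M.
Proof.
have mulE n (B1 C1 : zpmat N) (a b : 'I_N) : (zpmx n B1 *m zpmx n C1) a b - (1%:M : 'M[int]_N) a b =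
   (\sum_(c < N) res p n (B1 a c) * res p n (C1 c b)) - (a == b)%:Z.
  by rewrite !mxE; congr (_ - _); [apply: eq_bigr => c _; rewrite !mxE|rewrite -natz].
split=> -[hB [C [hC h]]]; split=> //; exists C; split=> // n.
  by split; apply/eqm_dvd => a b; rewrite mulE; have [] := h n a b.
move=> a b; rewrite -!mulE; have [/eqm_dvd h1 /eqm_dvd h2] := h n.
by split; [exact: h1|exact: h2].
Qed.

Definition diagk m (k : sing_t N) : 'rV[int]_N := \row_i dentry p m (k i).

Definition decomp_at (Z : qpmat N) k (B C : zpmat N) m n :=
  eqm n (resmx p n m Z) (zpmx n B *m diag_mx (diagk m k) *m zpmx n C).

Lemma sing_relE Z k : sing_rel p Z k <->
  inDelta k /\ exists B C : zpmat N, [/\ isGL p B, isGL p C &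
   forall m, vanishes_below m Z -> bounded_by m k -> forall n, decomp_at Z k B C m n].
Proof.
have mulE n m (B C : zpmat N) (a b : 'I_N) :
   resmx p n m Z a b - (zpmx n B *m diag_mx (diagk m k) *m zpmx n C) a b =
   resq p n m (Z a b) - \sum_(i < N) res p n (B a i) * dentry p m (k i) * res p n (C i b).
  rewrite !mxE; congr (_ - _); apply: eq_bigr => i _.
  by rewrite mul_mx_diag !mxE.
split=> -[kD [B [C]]].
  case=> hB [hC h]; split=> //; exists B, C; split=> // m Vm Wm n.
  by apply/eqm_dvd => a b; rewrite mulE; apply: h.
case=> hB hC h; split=> //; exists B, C; split=> //; split=> // m Vm Wm n a b.
by rewrite -mulE; move: a b; apply/eqm_dvd; apply: h.
Qed.

Hypothesis p_pr : prime p.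
Let p0 : (0 < p)%N := prime_gt0 p_pr.

Lemma pz_neq0 n : pz n != 0.
Proof. by rewrite eqz_nat -lt0n expn_gt0 p0. Qed.

Lemma dentry_dvd m n ki : le_ext ki (Some m%:Z) ->
  (pz n %| dentry p m ki)%Z = le_ext ki (Some (m%:Z - n%:Z)).
Proof.
case: ki => [a|] /= am; last by rewrite dvdz0.
by rewrite dvdzE /= dvdn_Pexp2l ?prime_gt1 //; lia.
Qed.

(** The exponents of p^m diag(p^{-k_j}) are the m - k_j, so w_n counts the j with k_j <= m - n. *)
Lemma card_dvdset_diagk m n k : bounded_by m k ->
  #|dvdset p n (diagk m k)| = cnt_le k (m%:Z - n%:Z).
Proof.
move=> W; rewrite card_le_extE; apply: eq_card => j.
by rewrite !inE mxE dentry_dvd.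
Qed.

Lemma isGL_red n B : isGL p B -> map_mx (intr : int -> 'F_p) (zpmx n.+1 B) \in unitmx.
Proof.
case/isGLE=> _ [C [_ /(_ n.+1) [[E h] _]]].
suff : map_mx (intr : int -> 'F_p) (zpmx n.+1 B) *m map_mx (intr :
  int -> 'F_p) (zpmx n.+1 C) = 1%:M.
  by case/mulmx1_unit.
by rewrite -map_mxM h map_mxD (red_scale p_pr) addr0 map_mx1.
Qed.

Lemma dentryD m e ki : le_ext ki (Some m%:Z) -> dentry p (m + e) ki = pz e * dentry p m ki.
Proof.
case: ki => [a|] /= am; last by rewrite mulr0.
by rewrite -PoszM -expnD; congr (_ ^ _)%N%:Z; lia.
Qed.

Lemma diagkD m e k : bounded_by m k -> diag_mx (diagk (m + e) k) = pz e *: diag_mx (diagk m k).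
Proof.
by move=> W; apply/matrixP=> i j; rewrite !mxE dentryD // mulrnAr.
Qed.

Lemma resmxD n m e (Z : qpmat N) : vanishes_below m Z ->
  resmx p (e + n) (m + e) Z = pz e *: resmx p n m Z.
Proof.
move=> V; apply/matrixP=> a b; rewrite !mxE /resq -PoszM; congr (_%:Z).
rewrite big_split_ord /= big1 ?add0n => [|j _]; last first.
  by rewrite V ?mul0n //; have := ltn_ord j; lia.
rewrite big_distrr; apply: eq_bigr => j _ /=.
rewrite expnD mulnCA; congr (_ * (Z a b _ * _))%N; lia.
Qed.

(* Multiplying the identity at (m, n) by p^e gives the identity at (m + e, n + e). *)
Lemma decomp_at_shift (Z : qpmat N) k B C m n e : vanishes_below m Z -> bounded_by m k ->
  decomp_at Z k B C m n <-> decomp_at Z k B C (m + e) (e + n).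
Proof.
move=> V W; rewrite /decomp_at resmxD // diagkD //.
rewrite -scalemxAr -scalemxAl.
have BB : eqm n (zpmx (e + n) B *m diag_mx (diagk m k) *m zpmx (e + n) C)
                (zpmx n B *m diag_mx (diagk m k) *m zpmx n C).
  apply: eqm_mul; last exact: zpmxD.
  by apply: eqm_mul; [exact: zpmxD|exact: eqm_refl].
have cancel (X Y : 'M[int]_N) : eqm (e + n) (pz e *: X) (pz e *: Y) <-> eqm n X Y.
  split=> [/eqm_dvd h|[E ->]].
    apply/eqm_dvd => a b; have := h a b; rewrite !mxE -mulrBr expnD PoszM.
    by rewrite dvdz_mul2l // pz_neq0.
  by exists E; rewrite scalerDr scalerA -PoszM expnD.
split=> h; first by apply/cancel/(eqm_trans h)/eqm_sym.
by apply: eqm_trans BB; apply/cancel.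
Qed.

Lemma digit_sum_lt n (z : nat -> nat) : (forall j, (z j < p)%N) ->
  (\sum_(j < n) z j * p ^ j < p ^ n)%N.
Proof.
move=> zp; elim: n => [|n IH]; first by rewrite big_ord0.
rewrite big_ord_recr /= expnS.
apply: (@leq_trans (p ^ n + z n * p ^ n)); first by rewrite ltn_add2r.
by rewrite -mulSn leq_mul2r zp orbT.
Qed.

(** [sing_rel] gives an identity only for those m for which p^m Z is already integral, so
    integrality at a bound m of k is derived first. The kernel sizes are then those of the diagonal
    factor. *)
Lemma sing_rel_levelker (Z : qpmat N) k m m' : (forall a b j, (Z a b j < p)%N) ->
  vanishes_below m' Z -> bounded_by m k -> sing_rel p Z k ->
  vanishes_below m Z /\
  forall n, #|levelker p n (resmx p n m Z)| = (p ^ cnt_le k (m%:Z - n%:Z))%N.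
Proof.
move=> Zp V' W /sing_relE[kD [B [C [GB GC h]]]].
have V : vanishes_below m Z.
  have V2 : vanishes_below (m + m') Z by rewrite addnC; exact: vanishes_belowD.
  (* At m + m' the diagonal factor is p^{m'} times an integral one, so p^{m+m'} Z vanishes modulo
     p^{m'}: the digits of Z at positions -(m + m') to -m - 1 are zero. *)
  have := h _ V2 (bounded_byD m' W) m'.
  rewrite /decomp_at diagkD // -scalemxAr -scalemxAl => /eqm_dvd hd a b j jm.
  case: (ltP j (- (m + m')%N%:Z)) => jm'; first exact: V2.
  have := hd a b; rewrite [X in (_ - X)%R]mxE => hd'.
  have : (pz m' %| resq p m' (m + m') (Z a b))%Z.
    have -> : resq p m' (m + m') (Z a b) = resmx p m' (m + m') Z a b by rewrite mxE.
    rewrite -[X in (_ %| X)%Z](subrK (pz m' * (zpmx m' B *m diag_mx (diagk m k) *m zpmx m' C) a b)).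
    by apply: rpredD => //; rewrite dvdz_mulr.
  rewrite /resq dvdzE /= => pd; have {pd}/eqP : (\sum_(i < m') Z a b (i%:Z - (m + m')%N%:Z)%R *
    p ^ i = 0)%N.
    have lt := @digit_sum_lt m' (fun i => Z a b (i%:Z - (m + m')%N%:Z)) (fun i => Zp a b _).
    apply/eqP; rewrite -leqn0 leqNgt; apply/negP => s0.
    by rewrite gtnNdvd in pd.
  rewrite sum_nat_eq0 => /forallP h0.
  have jlt : (`|(j + (m + m')%N%:Z)%R|%N < m')%N by lia.
  have := h0 (Ordinal jlt); rewrite /= muln_eq0 expn_eq0 -[(p == 0)%N]negbK -lt0n p0 orbF => /eqP
    <-.
  by congr (Z a b _); lia.
(* Level 0 is treated apart, because [zpmx p 0 B] is the zero matrix and carries no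
   invertibility. *)
split=> // n; case: n => [|n].
  rewrite card_levelker0 // subr0 card_le_extE; congr (_ ^ _)%N.
  by rewrite -[LHS]card_ord; apply: eq_card => j; rewrite !inE W.
rewrite (eqm_levelker (h m V W n.+1)) (card_levelker_mul p_pr) ?isGL_red //.
by rewrite (card_levelker_diag p_pr) card_dvdset_diagk.
Qed.

End EqMod.

(** * Compactness of digit sequences *)

Section Konig.
Variables (T : finType) (Q : nat -> (nat -> T) -> Prop).
Hypothesis Q_down : forall n f, Q n.+1 f -> Q n f.
Hypothesis Q_ext : forall n f g, (forall i, (i < n)%N -> f i = g i) -> Q n f -> Q n g.

(** König's lemma over a finite alphabet: a prefix shared with solutions of every level can be
    prolonged by one letter with the same property. Since [Q n] depends only on the first n letters,
    the limit sequence is a solution at every level. *)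
Lemma konig : (forall n, exists f, Q n f) -> exists f, forall n, Q n f.
Proof.
move=> Q_ex.
have Qle n k f : (n <= k)%N -> Q k f -> Q n f.
  by move=> /subnK <-; elim: (k - n)%N => // d IH /Q_down.
pose extendable (s : nat -> T) k := forall n, exists2 f, Q n f & forall i, (i < k)%N -> f i = s i.
have step s k : extendable s k -> exists t, extendable (fun i => if (i < k)%N then s i else t) k.+1.
  move=> sk; apply: contrapT => /forallNP no.
  (* If every letter t failed at some level [bad t], a solution at the maximal such level would
     contradict the failure of its own letter. *)
  have /choice [bad badP] : forall t, exists n, forall f, Q n f ->
      ~ forall i, (i < k.+1)%N -> f i = if (i < k)%N then s i else t.
    move=> t; have := no t; rewrite -existsNE => -[n nf]; exists n => f Qf e.
    by apply: nf; exists f.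
  have [f Qf fs] := sk (\max_t bad t)%N.
  apply: (badP (f k) f); first by apply: Qle Qf; exact: leq_bigmax.
  by move=> i; rewrite ltnS leq_eqVlt => /orP[/eqP ->|ik]; rewrite ?ltnn // ik fs.
have [f0 _] := Q_ex 0%N.
have /choice [next nextP] : forall sk : (nat -> T) * nat, exists t, extendable sk.1 sk.2 ->
    extendable (fun i => if (i < sk.2)%N then sk.1 i else t) sk.2.+1.
  case=> s k /=.
  have [/step [t ht]|no] := pselect (extendable s k); first by exists t.
  by exists (f0 0%N) => /no.
pose fix approx k : nat -> T :=
  if k is k'.+1 then fun i => if (i < k')%N then approx k' i else next (approx k', k') else f0.
have approx_ext k : extendable (approx k) k.
  elim: k => [|k IH]; last exact: (nextP (approx k, k)).
  by move=> n; have [f Qf] := Q_ex n; exists f.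
have stable i k : (i < k)%N -> approx k i = approx i.+1 i.
  elim: k => // k IH; rewrite ltnS leq_eqVlt => /orP[/eqP -> //|ik].
  by rewrite -IH //= ik.
exists (fun i => approx i.+1 i) => n.
have [f Qf fE] := approx_ext n n.
by apply: Q_ext Qf => i ik; rewrite fE // stable.
Qed.
End Konig.

Lemma card_ge_ord N (j : nat) : #|[set i : 'I_N | (j <= i)%N]%SET| = (N - j)%N.
Proof.
rewrite -sum1_card -[RHS]muln1 -sum_nat_const_nat big_geq_mkord.
by apply: eq_bigl => i; rewrite inE.
Qed.

(** A member j brings in everything from j on, and a non-member excludes everything up to j;
    comparing sizes decides membership. *)
Lemma upclosed_mem N (S : {set 'I_N}) :
  (forall i j : 'I_N, i \in S -> (i <= j)%N -> j \in S) ->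
  forall j, (j \in S) = (N - #|S| <= j)%N.
Proof.
move=> up j; have jN := ltn_ord j; have SN : (#|S| <= N)%N by rewrite -[X in (_ <= X)%N]card_ord
  max_card.
case: (boolP (j \in S)) => jS.
  have : ([set i : 'I_N | (j <= i)%N]%SET \subset S) by apply/fintype.subsetP => i; rewrite inE;
    exact: up.
  move/subset_leq_card; rewrite card_ge_ord; move: SN; move: #|S| => s sN h.
  by apply/esym; lia.
have : (S \subset [set i : 'I_N | (j.+1 <= i)%N]%SET).
  apply/fintype.subsetP => i iS; rewrite inE ltnNge; apply: contra jS; exact: up.
move/subset_leq_card; rewrite card_ge_ord; move: SN; move: #|S| => s sN h.
by apply/esym; lia.
Qed.

Lemma le_ext_trans y x z : le_ext x y -> le_ext y z -> le_ext x z.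
Proof. by case: x y z => [x|] [y|] [z|] //=; exact: le_trans. Qed.

Lemma le_ext_cnt N (k : sing_t N) c j : inDelta k ->
  le_ext (k j) (Some c) = (N - cnt_le k c <= j)%N.
Proof.
move=> kD; rewrite card_le_extE -upclosed_mem ?inE // => a b; rewrite !inE => ac ab.
exact: le_ext_trans (kD _ _ ab) ac.
Qed.

Lemma sing_ext N (k k' : sing_t N) : inDelta k -> inDelta k' ->
  (forall c, cnt_le k c = cnt_le k' c) -> k = k'.
Proof.
move=> kD kD' e; apply/ffunP => j.
have h c : le_ext (k j) (Some c) = le_ext (k' j) (Some c) by rewrite !le_ext_cnt // e.
case: (k j) (k' j) h => [a|] [b|] //= h.
- by congr Some; apply/le_anti; rewrite h lexx -h lexx.
(* The bound c = a - 1 separates a from -oo. *)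
- by have := h (a - 1); rewrite /=; lia.
- by have := h (b - 1); rewrite /=; lia.
Qed.

(** * Matching a Smith form with prescribed singular numbers *)

Section SmithMatching.
Variables (p N : nat).
Hypothesis p_pr : prime p.
Local Notation pz n := ((p ^ n)%N%:Z).
Local Notation red := (map_mx (intr : int -> 'F_p)).
Let p0 : (0 < p)%N := prime_gt0 p_pr.

Lemma unitmx_red (M : 'M[int]_N) : M \in unitmx -> red M \in unitmx.
Proof. by rewrite !unitmxE det_map_mx => h; apply: rmorph_unit. Qed.

Lemma smith_diag (A : 'M[int]_N) : exists (L R : 'M[int]_N) (d : 'rV[int]_N),
  [/\ L \in unitmx, R \in unitmx, A = L *m diag_mx d *m R &
      forall i j : 'I_N, (i <= j)%N -> (d 0%R i %| d 0%R j)%Z].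
Proof.
have [L uL [R uR [d sd AE]]] := int_Smith_normal_form A.
exists L, R, (\row_j d`_j); split=> //.
  by rewrite AE; congr (_ *m _ *m _); apply/matrixP=> i j; rewrite !mxE.
move=> i j ij; rewrite !mxE; case: (ltnP j (size d)) => jd;
  last by rewrite (nth_default _ jd) dvdz0.
have tr : transitive dvdz by move=> x y z; exact: dvdz_trans.
apply: (sorted_leq_nth tr dvdzz 0 sd) => //; rewrite inE //.
exact: leq_ltn_trans jd.
Qed.

Lemma dvdset_up n (d : 'rV[int]_N) :
  (forall i j : 'I_N, (i <= j)%N -> (d 0%R i %| d 0%R j)%Z) ->
  forall j, (j \in dvdset p n d) = (N - #|dvdset p n d| <= j)%N.
Proof.
move=> dd; apply: upclosed_mem => i j; rewrite !inE => pi ij.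
exact: dvdz_trans pi (dd _ _ ij).
Qed.

(** Up to level n the kernel sizes determine which d_j are divisible by p^i, both diagonals being
    ordered the same way. Hence d_j and p^{m-k_j} agree modulo p^n up to a factor prime to p, which
    the left matrix absorbs. *)
Lemma smith_matching n m (A : 'M[int]_N) (k : sing_t N) : inDelta k -> bounded_by m k ->
  (forall i, (i <= n)%N -> #|levelker p i A| = (p ^ cnt_le k (m%:Z - i%:Z))%N) ->
  exists B C : 'M[int]_N, [/\ red B \in unitmx, red C \in unitmx &
    eqm p n A (B *m diag_mx (diagk p m k) *m C)].
Proof.
move=> kD W hA; have [L [R [d [uL uR AE dd]]]] := smith_diag A.
have dE i j : (i <= n)%N -> (pz i %| d 0%R j)%Z = le_ext (k j) (Some (m%:Z - i%:Z)).
  move=> ilen; have := hA i ilen.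
  rewrite AE (card_levelker_mul p_pr) ?unitmx_red // (card_levelker_diag p_pr).
  move/(expnI (prime_gt1 p_pr)) => ci.
  have := dvdset_up i dd j; rewrite ci -le_ext_cnt // => <-.
  by rewrite inE.
(* If k_j <= m - n, both entries vanish modulo p^n and e_j = 1 will do. Otherwise e_j = d_j /
   p^{m-k_j} is prime to p, because p^{m-k_j+1} does not divide d_j. *)
have /choice [e eP] : forall j, exists e : int, ~~ (p %| e)%Z /\
    exists c, d 0%R j = e * dentry p m (k j) + pz n * c.
  move=> j; case: (boolP (le_ext (k j) (Some (m%:Z - n%:Z)))) => kj.
    exists 1; split; first by rewrite dvdzE /= dvdn1 gtn_eqF ?prime_gt1.
    have := kj; rewrite -(dentry_dvd p_pr n (W j)) => /dvdzP[x ->].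
    have := kj; rewrite -(dE n j) // => /dvdzP[y ->].
    by exists (y - x); ring.
  case kjE : (k j) kj => [a|] //= an; have := W j; rewrite kjE /= => am.
  have imE : m%:Z - `|m%:Z - a|%N%:Z = a by lia.
  have lin : (`|m%:Z - a|%N < n)%N by lia.
  have : (pz `|m%:Z - a|%N %| d 0%R j)%Z by rewrite dE ?(ltnW lin) // kjE /= imE.
  case/dvdzP=> x xE; exists x; split; last by exists 0; rewrite mulr0 addr0.
  apply/negP => px; have : (pz `|m%:Z - a|%N.+1 %| d 0%R j)%Z.
    by rewrite xE expnS PoszM dvdz_mul.
  by rewrite dE // kjE /=; lia.
exists (L *m diag_mx (\row_j e j)), R; split; [|exact: unitmx_red|].
  rewrite map_mxM unitmx_mul unitmx_red //= map_diag_mx unitmxE det_diag unitfE.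
  apply/prodf_neq0 => j _; rewrite !mxE (intr_Fp_eq0 p_pr).
  by have [] := eP j.
have /choice [c cP] : forall j, exists c, d 0%R j = e j * dentry p m (k j) + pz n * c.
  by move=> j; have [] := eP j.
rewrite AE; apply: eqm_mul; last exact: eqm_refl.
rewrite -mulmxA; apply: eqm_mul; first exact: eqm_refl.
exists (diag_mx (\row_j c j)); apply/matrixP=> i j.
rewrite mul_diag_mx !mxE cP; case: (i == j); rewrite ?mulr1n ?mulr0n //=; ring.
Qed.

Lemma digits_sum y n : (\sum_(j < n) (y %/ p ^ j) %% p * p ^ j = y %% p ^ n)%N.
Proof.
elim: n => [|n IH]; first by rewrite big_ord0 modn1.
rewrite big_ord_recr /= IH.
have lt : (y %% p ^ n + (y %/ p ^ n) %% p * p ^ n < p ^ n.+1)%N.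
  rewrite expnS; apply: (@leq_trans (p ^ n + (y %/ p ^ n) %% p * p ^ n)).
    by rewrite ltn_add2r ltn_pmod // expn_gt0 p0.
  by rewrite -mulSn leq_mul2r ltn_pmod // orbT.
rewrite {3}(divn_eq y (p ^ n)) {2}(divn_eq (y %/ p ^ n) p) mulnDl -mulnA -expnS -addnA modnMDl.
by rewrite (addnC (_ * _)%N) (modn_small lt).
Qed.

Lemma zpmx_of_int n (B : 'M[int]_N) : exists B' : zpmat N,
  (forall a b j, (B' a b j < p)%N) /\ eqm p n (zpmx p n B') B.
Proof.
exists (fun a b j => ((`|(B a b %% pz n)%Z|%N %/ p ^ j) %% p)%N); split.
  by move=> a b j; rewrite ltn_pmod.
apply/eqm_dvd => a b; rewrite mxE /res digits_sum.
have pn0 := pz_neq0 p_pr n.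
have h : (`|(B a b %% pz n)%Z|%N%:Z = (B a b %% pz n)%Z) by rewrite gez0_abs // modz_ge0.
rewrite modn_small; last by rewrite -ltz_nat h ltz_pmod // ltz_nat expn_gt0 p0.
by rewrite h -eqz_mod_dvd modz_mod.
Qed.
End SmithMatching.

Lemma bounded_by_ex N (k : sing_t N) : exists m, bounded_by m k.
Proof.
exists (\max_j (if k j is Some a then `|a|%N else 0%N))%N => j.
have := leq_bigmax (F := fun j => if k j is Some a then `|a|%N else 0%N) j.
by case: (k j) => //= a; lia.
Qed.

Lemma cnt_le_bounded N m (k : sing_t N) c : bounded_by m k -> m%:Z <= c -> cnt_le k c = N.
Proof.
move=> W mc; rewrite card_le_extE -[RHS]card_ord; apply: eq_card => j; rewrite !inE.
by have := W j; case: (k j) => //= a; lia.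
Qed.

(** * Characterising the singular numbers by kernel sizes *)

Section SingCharacterization.
Variables (p N : nat).
Hypothesis p_pr : prime p.
Let p0 : (0 < p)%N := prime_gt0 p_pr.

Lemma decomp_at_down (Z : qpmat N) k B C m n e :
  decomp_at p Z k B C m (e + n) -> decomp_at p Z k B C m n.
Proof.
move=> /eqm_downD h; apply: eqm_trans (eqm_trans h _).
  by apply: eqm_sym; exact: resmx_tower.
apply: eqm_mul; last exact: zpmxD.
by apply: eqm_mul; [exact: zpmxD|exact: eqm_refl].
Qed.

Lemma levelker_resmx (Z : qpmat N) m i n : (i <= n)%N ->
  levelker p i (resmx p n m Z) = levelker p i (resmx p i m Z).
Proof.
by move=> /subnK <-; apply: eqm_levelker; exact: resmx_tower.
Qed.

Lemma inverse_eqm n (B : 'M[int]_N) : map_mx (intr : int -> 'F_p) B \in unitmx ->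
  exists B', eqm p n (B *m B') 1%:M /\ eqm p n (B' *m B) 1%:M.
Proof.
by move=> /(inverse_mod p_pr n)[B' [E [E' [h1 h2]]]]; exists B'; split; [exists E'|exists E].
Qed.

(** Modulo each p^n, [smith_matching] provides B and C, which have inverses modulo p^n; [konig]
    glues such approximations into p-adic matrices. *)
Lemma sing_rel_of_levelker (Z : qpmat N) (k : sing_t N) m :
  inDelta k -> bounded_by m k -> vanishes_below m Z ->
  (forall n, #|levelker p n (resmx p n m Z)| = (p ^ cnt_le k (m%:Z - n%:Z))%N) ->
  sing_rel p Z k.
Proof.
move=> kD W V hA.
(* A letter of [T] lists the digits at one position of all entries of four matrices: the first
   boolean selects B or C, the second the matrix itself or its inverse. *)
pose T := {ffun (bool * bool) * ('I_N * 'I_N) -> 'I_p}.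
pose ent (f : nat -> T) c : zpmat N := fun a b j => f j (c, (a, b)).
pose mx n f c := zpmx p n (ent f c).
pose tt := (true, true); pose tf := (true, false); pose ft := (false, true);
  pose ff := (false, false).
pose Q n f := [/\ eqm p n (mx n f tt *m mx n f tf) 1%:M, eqm p n (mx n f tf *m mx n f tt) 1%:M,
   eqm p n (mx n f ft *m mx n f ff) 1%:M, eqm p n (mx n f ff *m mx n f ft) 1%:M &
   eqm p n (resmx p n m Z) (mx n f tt *m diag_mx (diagk p m k) *m mx n f ft)].
have mxS n f c : eqm p n (mx n f c) (mx n.+1 f c) by apply/eqm_sym/zpmxS.
have [f fP] : exists f, forall n, Q n f.
  apply: konig.
  - move=> n f [h1 h2 h3 h4 h5].
    have mulS c c' : eqm p n.+1 (mx n.+1 f c *m mx n.+1 f c') 1%:M ->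
      eqm p n (mx n f c *m mx n f c') 1%:M.
      by move=> /eqm_down; apply: eqm_trans; exact: eqm_mul.
    split; try exact: mulS.
    apply: eqm_trans (eqm_sym (resmxS p n m Z)) _.
    apply: (eqm_trans (eqm_down h5)); apply: eqm_mul; last exact/eqm_sym/mxS.
    by apply: eqm_mul; [exact/eqm_sym/mxS|exact: eqm_refl].
  - move=> n f g fg.
    have e c : mx n f c = mx n g c.
      apply/matrixP=> a b; rewrite !mxE /res; congr (_%:Z); apply: eq_bigr => i _.
      by rewrite /ent fg.
    by rewrite /Q !e.
  - move=> n.
    have [B [C [uB uC AE]]] : exists B C : 'M[int]_N, [/\ map_mx (intr : int -> 'F_p) B \in unitmx,
        map_mx (intr : int -> 'F_p) C \in unitmx & eqm p n (resmx p n m Z) (B *m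
          diag_mx (diagk p m k) *m C)].
      by apply: (smith_matching p_pr kD W) => i ilen; rewrite levelker_resmx.
    have [B' [BB' B'B]] := inverse_eqm n uB; have [C' [CC' C'C]] := inverse_eqm n uC.
    have /choice [D hD] : forall c : bool * bool, exists D :
      zpmat N, (forall a b j, (D a b j < p)%N) /\
        eqm p n (zpmx p n D) (if c.1 then if c.2 then B else B' else if c.2 then C else C').
      by move=> c; exact: zpmx_of_int.
    exists (fun j => [ffun cab : (bool * bool) * ('I_N *
      'I_N) => Ordinal ((hD cab.1).1 cab.2.1 cab.2.2 j)]).
    set f := fun j => _.
    have e c : mx n f c = zpmx p n (D c).
      by apply/matrixP=> a b; rewrite !mxE /res; congr (_%:Z); apply: eq_bigr => i _;
        rewrite /ent /f ffunE.
    have eB := (hD tt).2; have eB' := (hD tf).2; have eC := (hD ft).2; have eC' := (hD ff).2.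
    rewrite /Q !e; split; [apply: eqm_trans BB'|apply: eqm_trans B'B|apply: eqm_trans CC'|apply:
      eqm_trans C'C|];
      try exact: eqm_mul.
    apply: (eqm_trans AE); apply: eqm_mul; last exact: eqm_sym.
    by apply: eqm_mul; [exact: eqm_sym|exact: eqm_refl].
have entp c a b j : (ent f c a b j < p)%N by rewrite /ent.
apply/sing_relE; split=> //; exists (ent f tt), (ent f ft); split.
- apply/isGLE; split=> //; exists (ent f tf); split=> // n.
  by have [h1 h2 _ _ _] := fP n; split.
- apply/isGLE; split=> //; exists (ent f ff); split=> // n.
  by have [_ _ h3 h4 _] := fP n; split.
have dec n : decomp_at p Z k (ent f tt) (ent f ft) m n by have [_ _ _ _] := fP n.
(* The identity holds at m modulo every power of p. Shifting by a power of p transfers it to m', and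
   for m <= m' the modulus so obtained is lowered again. *)
move=> m' V' W' n; case: (leqP m m') => mm.
  rewrite -(subnKC mm); apply: (@decomp_at_down _ _ _ _ _ n (m' - m)).
  by apply/(decomp_at_shift p_pr (ent f tt) (ent f ft) n (m' - m) V W).
apply/(decomp_at_shift p_pr (ent f tt) (ent f ft) n (m - m') V' W').
by rewrite subnKC // ltnW.
Qed.

(** The exponents c_n of the kernel sizes decrease weakly from c_0 = N, and k_j is read off from the
    first level i at which j < N - c_i. *)
Lemma levelker_sing_ex (Z : qpmat N) m : exists k : sing_t N,
  [/\ inDelta k, bounded_by m k &
   forall n, #|levelker p n (resmx p n m Z)| = (p ^ cnt_le k (m%:Z - n%:Z))%N].
Proof.
have /choice [c cP] : forall n, exists c, (c <= N)%N /\ #|levelker p n (resmx p n m Z)| = (p ^ c)%N.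
  move=> n; have [L [R [d [uL uR -> _]]]] := smith_diag (resmx p n m Z).
  exists #|dvdset p n d|; split; first by rewrite -[X in (_ <= X)%N]card_ord max_card.
  by rewrite (card_levelker_mul p_pr) ?unitmx_red // (card_levelker_diag p_pr).
have p1 := prime_gt1 p_pr.
have cS n : (c n.+1 <= c n)%N.
  rewrite -(leq_exp2l _ _ p1) -(cP n).2 -(cP n.+1).2 -(levelker_resmx Z m (leqnSn n)).
  apply/subset_leq_card/fintype.subsetP => v /levelkerP[u [y [uv uA]]].
  apply/levelkerP; exists u, (p%:Z *: y); split=> //.
  by rewrite uA scalerA -PoszM expnSr.
have c_anti i n : (i <= n)%N -> (c n <= c i)%N.
  by move=> /subnK <-; elim: (n - i)%N => // e; apply: leq_trans; exact: cS.
have c0 : c 0%N = N.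
  apply/eqP; rewrite -(eqn_exp2l _ _ p1) -(cP 0%N).2.
  by rewrite (card_levelker0 p_pr).
have /choice [k kP] : forall j : 'I_N, exists kj : option int, forall n,
    le_ext kj (Some (m%:Z - n%:Z)) = (N - c n <= j)%N.
  move=> j; case: (pselect (exists n, (j < N - c n)%N)) => [ex|no]; last first.
    exists None => n; apply/esym; rewrite leqNgt; apply/negP => h.
    by apply: no; exists n.
  case: (ex_minnP ex) => i ji imin.
  (* Level i is the first one not reached by the j-th exponent, which is therefore i - 1, so that
     k_j = m - (i - 1). When there is no such level, k_j = -oo was chosen above. *)
  exists (Some (m%:Z - i%:Z + 1)) => n /=; apply/idP/idP => [h|h].
    by rewrite leqNgt; apply/negP => /imin; lia.
  have : (n < i)%N.
    by rewrite ltnNge; apply/negP => /c_anti h'; move: ji; rewrite ltnNge => /negP; apply; lia.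
  by lia.
pose kk : sing_t N := [ffun j => k j].
have kkE j n : le_ext (kk j) (Some (m%:Z - n%:Z)) = (N - c n <= j)%N by rewrite ffunE kP.
have W : bounded_by m kk by move=> j; have := kkE j 0%N; rewrite subr0 c0 subnn.
exists kk; split=> // [i j ij|n].
  case ki : (kk i) => [a|]; last first.
    have noi n : (N - c n <= i)%N by rewrite -kkE ki.
    case kj : (kk j) => [b|] //=; have /= := kkE j `|(m%:Z - b + 1)%R|%N.
    have := W j; rewrite kj /= => bm.
    by rewrite (leq_trans (noi _) ij); lia.
  have := W i; rewrite ki /= => am.
  have aE : a = m%:Z - `|m%:Z - a|%N%:Z by lia.
  by rewrite aE kkE (leq_trans _ ij) // -kkE -aE ki /=.
rewrite (cP n).2 card_le_extE; congr (_ ^ _)%N.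
have <- : #|[set j : 'I_N | (N - c n <= j)%N]%SET| = c n by rewrite card_ge_ord subKn // (cP n).1.
by apply: eq_card => j; rewrite !inE kkE.
Qed.

Lemma sing_rel_unique (Z : qpmat N) m k k' : (forall a b j, (Z a b j < p)%N) ->
  vanishes_below m Z -> sing_rel p Z k -> sing_rel p Z k' -> k = k'.
Proof.
move=> Zp V sk sk'; have [m1 W1] := bounded_by_ex k; have [m2 W2] := bounded_by_ex k'.
have {}W1 := bounded_byD m2 W1; have {}W2 := bounded_byD m1 W2; rewrite addnC in W2.
have [_ h] := sing_rel_levelker p_pr Zp V W1 sk.
have [_ h'] := sing_rel_levelker p_pr Zp V W2 sk'.
have [kD _] := sk; have [kD' _] := sk'.
apply: sing_ext => // c; case: (leP (m1 + m2)%N%:Z c) => mc;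
  first by rewrite !(cnt_le_bounded _ mc).
have -> : c = (m1 + m2)%N%:Z - `|(m1 + m2)%N%:Z - c|%N%:Z by lia.
by apply: (expnI (prime_gt1 p_pr)); rewrite -h -h'.
Qed.

(** Existence and uniqueness of the singular numbers ensure that [xget] does not fall back on its
    default. *)
Lemma SingE (Z : qpmat N) m k : (forall a b j, (Z a b j < p)%N) -> vanishes_below m Z ->
  Sing p Z = k <-> sing_rel p Z k.
Proof.
move=> Zp V; split=> [<-|sk].
  have [k' [kD W h]] := levelker_sing_ex Z m.
  exact: (xgetPex _ (ex_intro _ k' (sing_rel_of_levelker kD W V h))).
by apply: xget_unique => // k' sk'; exact: (sing_rel_unique Zp V sk' sk).
Qed.

Lemma Sing_phi_event (R : realType) m (k : sing_t N) (x : R) :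
  (0 < N)%N -> inDelta k -> bounded_by m k ->
  (0 <= x /\ Sing p (phi p x) = k) <->
  (forall n, event p N m (fun n => cnt_le k (m%:Z - n%:Z)) n x).
Proof.
move=> N0 kD W; have Zp (a b : 'I_N) j := phi_lt p_pr x a b j.
have w0 : cnt_le k (m%:Z - 0%N%:Z) = N by rewrite subr0 (cnt_le_bounded W).
split=> [[x0 Sk] n|h].
  have [m' V'] := vanishes_phi_ex N p_pr x0.
  have [V h] := sing_rel_levelker p_pr Zp V' W ((SingE k Zp V').1 Sk).
  by apply/(eventE p_pr m n x N0 w0).
have [x0 V _] := (eventE p_pr m 0 x N0 w0).1 (h 0%N).
split=> //; apply/(SingE k Zp V); apply: (sing_rel_of_levelker kD W V) => n.
by have [_ _] := (eventE p_pr m n x N0 w0).1 (h n); apply.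
Qed.

End SingCharacterization.

(** * Telescoping and convergence *)

Section TailCounts.
Variables (N : nat) (k : sing_t N) (m : nat).
Hypothesis km : bounded_by m k.

Lemma cnt_le_leqN c : (cnt_le k c <= N)%N.
Proof. by rewrite card_le_extE -[X in (_ <= X)%N]card_ord max_card. Qed.

Lemma useq_leqN i : (useq k i <= N)%N. Proof. exact: leq_subr. Qed.

Lemma useqS i : (useq k i.+1 <= useq k i)%N.
Proof.
apply: leq_sub2l; rewrite !card_le_extE; apply/subset_leq_card/fintype.subsetP => j.
by rewrite !inE; case: (k j) => //= b; lia.
Qed.

Lemma useq_large i : (m <= i)%N -> useq k i = 0%N.
Proof. by move=> mi; rewrite /useq (cnt_le_bounded km) ?subnn // lez_nat. Qed.

Lemma sub_useq i : (N - useq k i)%N = cnt_le k i%:Z.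
Proof. by rewrite subKn // cnt_le_leqN. Qed.

(** Layer counting: a positive k_j is the number of i in [0, m) with k_j > i, and exchanging the two
    sums produces the u_i. *)
Lemma gamma_prodE (R : realType) (p : nat) :
  \prod_(i < N) (if k i is Some b then (if (0 < b)%R then pR R p ^+ `|b|%N else 1) else 1) =
  pR R p ^+ (\sum_(i < m) useq k i)%N.
Proof.
have sum_lt c : (c <= m)%N -> (\sum_(i < m) (i < c)%N = c)%N.
  suff -> : (\sum_(i < m) (i < c)%N = minn m c)%N by move/minn_idPr.
  by elim: (m) => [|j IH]; rewrite ?big_ord0 ?min0n // big_ord_recr /= IH; lia.
transitivity (\prod_(j < N) pR R p ^+ (\sum_(i < m) ~~ le_ext (k j) (Some i%:Z))%N).
  apply: eq_bigr => j _; have := km j; case: (k j) => [b|] /=; last by rewrite big1.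
  move=> bm; case: ltP => b0.
    rewrite -[in LHS](sum_lt `|b|%N); last by lia.
    by congr (_ ^+ _); apply: eq_bigr => i _; congr (nat_of_bool _); lia.
  by rewrite big1 // => i _; rewrite (le_trans b0).
rewrite -expr_sum exchange_big; congr (_ ^+ _); apply: eq_bigr => i _.
rewrite /useq card_le_extE; set S := [set _ | _]%SET.
have -> : (\sum_(j < N) ~~ le_ext (k j) (Some i%:Z))%N = #|~: S|.
  by rewrite -sum1_card [RHS]big_mkcond; apply: eq_bigr => j _; rewrite !inE; case: le_ext.
by rewrite -(addKn #|S| #|~: S|) cardsC card_ord.
Qed.
End TailCounts.

(** * Telescoping the h-transform *)

Section Telescoping.
Variables (R : realType) (p N : nat) (s : R).
Hypotheses (p_pr : prime p) (s_gt : -1 < s).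
Local Notation t := (qinv R p).
Local Notation a := (aS p s).
Local Notation g := (pR R p `^ (- s - 2 * N%:R)).

Let qt := @qpoch_qinv_neq0 R p p_pr.
Let qa n : qpoch a t n != 0. Proof. by rewrite lt0r_neq0 // (qpoch_aS_gt0 p_pr). Qed.
Let pt : p%:R * t = 1.
Proof. by rewrite divff // lt0r_neq0 // (natr_prime_gt0 R p_pr). Qed.

(* The function h of the h-transform relating P^(0) and P^(s), see [Pker_haar]. *)
Definition tail_weight (y : nat) : R :=
  t ^+ (y * y.-1) * a ^+ y / (qpoch t t (N - y) ^+ 2 * qpoch t t y * qpoch a t y).

Lemma gamma_factor : g = a * p%:R * t ^+ (2 * N).
Proof.
have pp := natr_prime_gt0 R p_pr; have pn0 : pR R p != 0 by rewrite lt0r_neq0.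
have -> : p%:R = pR R p `^ 1 by rewrite powRr1 // ler0n.
rewrite /qinv exprVn -powR_invn ?ler0n // -!powRD ?pn0 ?implybT //.
by congr (_ `^ _); rewrite natrM; ring.
Qed.

(** Collects the powers of p that Haar measure, P^(0) and gamma contribute at one level. With d = N
    - u the exponent, apart from a^u, is N^2 - d^2 + u - 2 N u = -u (u - 1). *)
Lemma haar_weight u : (u <= N)%N ->
  p%:R ^+ (N ^ 2) * (t ^+ ((N - u) * (N - u).-1) * t ^+ (N - u)) * g ^+ u =
    t ^+ (u * u.-1) * a ^+ u.
Proof.
move=> uN; rewrite gamma_factor; set d := (N - u)%N.
have NE : N = (u + d)%N by rewrite subnKC.
have qt1 k : p%:R ^+ k * t ^+ k = 1 by rewrite -exprMn pt expr1n.
rewrite -exprD (_ : (d * d.-1 + d = d * d)%N); last by case: d {NE} => //= d; lia.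
rewrite !exprMn -exprM.
have u2 : (2 * N * u = u * u.-1 + u + (u * d + u * d + u * u))%N.
  by rewrite NE; case: (u) => [|u'] /=; lia.
have N2 : (N ^ 2 = d * d + (u * d + u * d + u * u))%N by rewrite NE -mulnn; lia.
rewrite u2 N2 !exprD.
have := qt1 (d * d)%N; have := qt1 (u * d)%N; have := qt1 (u * u)%N; have := qt1 u.
rewrite -!exprD.
set x1 := p%:R ^+ u; set x2 := t ^+ u; set y1 := p%:R ^+ (u * u); set y2 := t ^+ (u * u).
set z1 := p%:R ^+ (u * d); set z2 := t ^+ (u * d); set w1 := p%:R ^+ (d * d);
  set w2 := t ^+ (d * d).
rewrite !exprD -/x1 -/x2 -/y1 -/y2 -/z1 -/z2 -/w1 -/w2 => hx hy hz hw.
transitivity ((w1 * w2) * (z1 * z2) * (z1 * z2) * (y1 * y2) * (x1 * x2) * (t ^+ (u * u.-1) *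
  a ^+ u)); first by ring.
by rewrite hx hy hz hw !mul1r.
Qed.

(** The Haar chain steps from N - u' to N - u, whereas P^(s) steps from u to u': the step is
    reversed in time, and [tail_weight] compensates for it. *)
Lemma Pker_haar u u' : (u' <= u)%N -> (u <= N)%N ->
  p%:R ^+ (N ^ 2) * Pker p (0 : R) (N - u')%N (N - u)%N * g ^+ u * tail_weight u' =
    Pker p s u u' * tail_weight u.
Proof.
move=> uu uN; rewrite /Pker leq_sub2l // uu !weightE // aS0 -/t.
have -> : (N - u' - (N - u) = u - u')%N by lia.
rewrite /tail_weight -(haar_weight uN); field.
by rewrite !qt !qa.
Qed.

(** The starting law is [tail_weight] up to a constant, so it is what the telescoped product leaves
    at u_0. *)
Lemma piN_tail_weight u : (u <= N)%N ->
  piN p N s (N - u) = cM p N s * qpoch t t N ^+ 2 * tail_weight u.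
Proof.
move=> uN; rewrite /piN /cM /tail_weight weightE // subKn //; field.
by rewrite !qt !qa.
Qed.

Lemma tail_weight0 : qpoch t t N ^+ 2 * tail_weight 0 = 1.
Proof.
rewrite /tail_weight subn0 mul0n !expr0 /qpoch !big_ord0; field.
exact: qt.
Qed.

Variables (k : sing_t N) (m : nat).
Hypothesis km : bounded_by m k.

Lemma tail_prod j :
  \prod_(i < j) (p%:R ^+ (N ^ 2) * Pker p (0 : R) (N - useq k i.+1)%N (N - useq k i)%N *
    g ^+ useq k i)
     * tail_weight (useq k j) =
  (\prod_(i < j) Pker p s (useq k i) (useq k i.+1)) * tail_weight (useq k 0).
Proof.
elim: j => [|j IH]; first by rewrite !big_ord0.
rewrite !big_ord_recr /= -mulrA Pker_haar ?useqS ?useq_leqN // mulrCA IH; ring.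
Qed.

(** The first m steps of the Haar chain, read backwards, concern the levels above 0 and telescope by
    [tail_prod] into the factors pi_N and P^(s). The other n steps are the P^(0) chain of the
    v_i. *)
Lemma partial_prodE n : (m <= n)%N ->
  partial_prod p s k n =
  cM p N s * (pR R p ^+ (\sum_(i < m) useq k i)%N) `^ (- s - 2 * N%:R) *
  ((p ^ (m * N ^ 2))%:R *
    \prod_(i < m + n) Pker p (0 : R) (cnt_le k (m%:Z - i%:Z)) (cnt_le k (m%:Z - i.+1%:Z))).
Proof.
move=> mn; rewrite /partial_prod.
have [tw0 tw0E] : exists x, x = tail_weight (useq k 0) by exists (tail_weight (useq k 0)).
have -> : piN p N s (vseq k 0) = cM p N s * qpoch t t N ^+ 2 * tw0.
  by rewrite tw0E -piN_tail_weight ?useq_leqN // sub_useq /vseq oppr0.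
have -> : \prod_(i < n) Pker p s (useq k i) (useq k i.+1) =
          \prod_(i < m) Pker p s (useq k i) (useq k i.+1).
  (* From index m on all u_i are 0, and P^(s)(0, 0) = 1. *)
  rewrite -(subnKC mn) big_split_ord /= [X in _ * X]big1 ?mulr1 // => i _.
  rewrite !(useq_large km) ?leq_addr ?(leq_trans (leq_addr i m)) //.
  by rewrite /Pker leqnn weightE // mul0n !expr0 /qpoch !big_ord0 !mulr1 divr1.
rewrite big_split_ord /=.
have -> : \prod_(i < n) Pker p (0 : R) (cnt_le k (m%:Z - (m + i)%N%:Z)) (cnt_le k (m%:Z - (m +
  i).+1%:Z)) =
     \prod_(i < n) Pker p (0 : R) (vseq k i) (vseq k i.+1).
  apply: eq_bigr => i _; rewrite /vseq.
  have -> : m%:Z - (m + i)%N%:Z = - i%:Z by lia.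
  by have -> : m%:Z - (m + i).+1%:Z = - i.+1%:Z by lia.
rewrite !mulrA; congr (_ * _).
have -> : \prod_(i < m) Pker p (0 : R) (cnt_le k (m%:Z - i%:Z)) (cnt_le k (m%:Z - i.+1%:Z)) =
     \prod_(i < m) Pker p (0 : R) (N - useq k i.+1)%N (N - useq k i)%N :> R.
  rewrite (reindex_inj rev_ord_inj); apply: eq_bigr => -[i im] _ /=.
  rewrite !sub_useq.
  have -> : m%:Z - (m - i.+1)%N%:Z = i.+1%:Z by lia.
  by have -> : m%:Z - (m - i.+1).+1%:Z = i%:Z by lia.
have -> : (pR R p ^+ (\sum_(i < m) useq k i)%N) `^ (- s - 2 * N%:R) = \prod_(i < m) g ^+ useq k i.
  rewrite -expr_sum -powR_mulrn ?ler0n // -powRrM mulrC powRrM powR_mulrn ?powR_ge0 //.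
have -> : (p ^ (m * N ^ 2))%:R = \prod_(i < m) (p%:R ^+ (N ^ 2)) :> R.
  by rewrite prodr_const card_ord -exprM mulnC natrX.
have e : \prod_(i < m) (p%:R ^+ (N ^ 2) * Pker p (0 :
  R) (N - useq k i.+1)%N (N - useq k i)%N * g ^+ useq k i) =
    \prod_(i < m) Pker p s (useq k i) (useq k i.+1) * tw0 * qpoch t t N ^+ 2.
  (* The telescoped product ends at u_m = 0, where [tail_weight0] supplies the normalisation. *)
  rewrite tw0E -tail_prod (useq_large km (leqnn m)) -mulrA (mulrC (tail_weight 0)) tail_weight0.
  by rewrite mulr1.
transitivity (cM p N s * (\prod_(i < m) Pker p s (useq k i) (useq k i.+1) *
      tw0 * qpoch t t N ^+ 2)); first by ring.
by rewrite -e !big_split /=; ring.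
Qed.

End Telescoping.

(** * The law of the singular numbers *)

Section SingularLaw.
Variables (R : realType) (p N m : nat) (s : R) (k : sing_t N).
Hypotheses (p_pr : prime p) (N_gt0 : (0 < N)%N) (kD : inDelta k) (km : bounded_by m k).

Let w (n : nat) := cnt_le k (m%:Z - n%:Z).
Let ev := @event p N m w R.
Let D := [set x : R | 0 <= x /\ Sing p (phi p x) = k].
Let w0 : w 0%N = N.
Proof. by rewrite /w subr0 (cnt_le_bounded km). Qed.

Let ev_measure n := @event_measure p N m p_pr w w0 R n.

Lemma sing_setE : D = \bigcap_n ev n.
Proof.
apply/seteqP; split=> x /=.
  by move=> /(Sing_phi_event p_pr x N_gt0 kD km) h n _; exact: h.
by move=> h; apply/(Sing_phi_event p_pr x N_gt0 kD km) => n; exact: h.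
Qed.

Lemma measurable_sing_set : measurable D.
Proof.
rewrite sing_setE; apply: bigcap_measurable => [|n _]; first by exists 0%N.
exact: (ev_measure n).1.
Qed.

(** Continuity from above along the decreasing events, the first of which has finite measure. *)
Lemma event_cvg : (fun n => lebesgue_measure (ev n)) @ \oo --> lebesgue_measure D.
Proof.
rewrite sing_setE; apply: (nonincreasing_cvg_mu (mu := @lebesgue_measure R) (F := ev)).
- by have [_ h] := ev_measure 0; rewrite [X in (X < _)%E]h ltry.
- by move=> n; exact: (ev_measure n).1.
- by rewrite -sing_setE; exact: measurable_sing_set.
- move=> i j ij; apply/subsetPset => x.
  move=> /(eventE p_pr _ _ _ N_gt0 w0)[x0 V h]; apply/(eventE p_pr _ _ _ N_gt0 w0).
  by split=> // l li; apply: h; apply: leq_trans ij.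
Qed.

Lemma mNE : (mN p s k =
  (cM p N s * (pR R p ^+ (\sum_(i < m) useq k i)%N) `^ (- s - 2 * N%:R))%:E * lebesgue_measure D)%E.
Proof.
rewrite /mN /MN [in RHS]EFinM -[RHS]muleA; congr (_ * _)%E.
rewrite -[RHS](integral_cst (@lebesgue_measure R) measurable_sing_set).
apply: eq_integral => x; rewrite inE => -[x0 Sk].
by rewrite /gammaZ Sk (gamma_prodE km).
Qed.

Lemma partial_prod_cvg : -1 < s -> (fun n => (partial_prod p s k n)%:E) @ \oo --> mN p s k.
Proof.
move=> s1; rewrite -(cvg_shiftn m) mNE.
set K := _ * _ `^ _.
(* The partial product of index n + m corresponds to the event at level m + (n + m), hence the shift
   by m + m. *)
have -> : (fun n => (partial_prod p s k (n + m))%:E) =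
          (fun n => (K%:E * lebesgue_measure (ev (n + (m + m))))%E).
  apply/funext => n; rewrite (partial_prodE p_pr s1 km) ?leq_addl //.
  by rewrite (ev_measure _).2 -EFinM addnCA.
apply: cvgeZl => //.
by rewrite (cvg_shiftn (m + m) (fun n => lebesgue_measure (ev n))); exact: event_cvg.
Qed.
End SingularLaw.

Theorem theorem3p5 (R : realType) (p N : nat) (s : R) :
  prime p -> (0 < N)%N -> -1 < s ->
  ((forall x : nat, (x <= N)%N -> 0 <= piN p N s x) /\
   \sum_(x < N.+1) piN p N s x = 1) /\
  (forall k : sing_t N, inDelta k ->
     (fun n => (partial_prod p s k n)%:E) @ \oo --> mN p s k).
Proof.
move=> p_pr N_gt0 s_gt; split.
  by split=> [x _|]; [exact: piN_ge0|exact: sum_piN].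
move=> k kD; have [m km] := bounded_by_ex k.
exact: (partial_prod_cvg p_pr N_gt0 kD km s_gt).
Qed.
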